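(* Let $p\in C^1([0,1];(0,+\infty))$, $r\in C^0([0,1];(0,+\infty))$, $q\in C^0([0,1])$ and real constants $g_0,v_0,g_1,v_1$ be such that (i) either $v_0>0$, or $v_0=0$ and $g_0<0$; (ii) either $v_1>0$, or $v_1=0$ and $g_1>0$; (iii) the Sturm-Liouville operator $A$ (with eigenvalues $\lambda_n$ and eigenfunctions $\phi_n$, see context) satisfies $\lambda_1>0$ and $\sum_{n=1}^{\infty}\lambda_n^{-1}\max_{0\le z\le 1}|\phi_n(z)|<+\infty$. Then for every $x_0\in C^2([0,1])$, $u\in C^1(\mathbb{R}_+\times[0,1])$ and $(d_0,d_1)\in\Phi(x_0,u)$ (see context), the unique solution $x\in C^0(\mathbb{R}_+\times[0,1])\cap C^1((0,+\infty)\times[0,1])$ of the boundary-value evolution problem (E) (see context) with initial condition $x_0$ satisfies, for all $\varepsilon,\omega>0$ and $t\ge0$, $$\|x[t]\|_{2,r}\le\sqrt{\frac{e^{-\lambda_1t}}{2-e^{-\lambda_1t}}}\,\|x[0]\|_{2,r}+C_0\sqrt{(1+\varepsilon^{-1})(1+\omega)}\max_{0\le s\le t}|d_0(s)|+C_1\sqrt{(1+\varepsilon)(1+\omega)}\max_{0\le s\le t}|d_1(s)|+\tilde C\sqrt{1+\omega^{-1}}\max_{0\le s\le t}\left(\max_{0\le z\le1}|u(s,z)|\right),$$ where $\|f\|_{2,r}:=\left(\int_0^1r(z)|f(z)|^2dz\right)^{1/2}$, $$C_0:=\frac{p(0)}{g_0^2+v_0^2}\sqrt{\sum_{n=1}^{\infty}\frac1{\lambda_n^2}\left|g_0\frac{d\phi_n}{dz}(0)-v_0\phi_n(0)\right|^2}=\frac{1}{\sqrt{g_0^2+v_0^2}}\|\tilde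 x\|_{2,r},$$ $$C_1:=\frac{p(1)}{g_1^2+v_1^2}\sqrt{\sum_{n=1}^{\infty}\frac1{\lambda_n^2}\left|v_1\phi_n(1)-g_1\frac{d\phi_n}{dz}(1)\right|^2}=\frac{1}{\sqrt{g_1^2+v_1^2}}\|\bar x\|_{2,r},$$ $$\tilde C:=\sqrt{\sum_{n=1}^{\infty}\frac1{\lambda_n^2}\left(\int_0^1r(z)|\phi_n(z)|dz\right)^2},$$ $\tilde x\in C^2([0,1])$ is the unique solution of $\frac{d}{dz}\left(p(z)\frac{d\tilde x}{dz}(z)\right)-q(z)\tilde x(z)=0$ for $z\in[0,1]$ with $g_0\tilde x(0)+v_0\frac{d\tilde x}{dz}(0)=\sqrt{g_0^2+v_0^2}$ and $g_1\tilde x(1)+v_1\frac{d\tilde x}{dz}(1)=0$, and $\bar x\in C^2([0,1])$ is the unique solution of $\frac{d}{dz}\left(p(z)\frac{d\bar x}{dz}(z)\right)-q(z)\bar x(z)=0$ for $z\in[0,1]$ with $g_0\bar x(0)+v_0\frac{d\bar x}{dz}(0)=0$ and $g_1\bar x(1)+v_1\frac{d\bar x}{dz}(1)=\sqrt{g_1^2+v_1^2}$.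
   Context: $\mathbb{R}_+=[0,+\infty)$. For a function $x$ on $\mathbb{R}_+\times[0,1]$, $x[t]$ denotes the profile $z\mapsto x(t,z)$. $L^2_r([0,1])$ is the space of (classes of) measurable $f:[0,1]\to\mathbb{R}$ with $\int_0^1 r(z)|f(z)|^2dz<+\infty$, with inner product $\int_0^1 r f g\,dz$. The Sturm-Liouville operator $A:D\to L^2_r([0,1])$ is $(Af)(z)=-\frac{1}{r(z)}(p(z)f'(z))'+\frac{q(z)}{r(z)}f(z)$, where $D$ is the set of all $f\in H^2(0,1)$ with $g_0f(0)+v_0f'(0)=g_1f(1)+v_1f'(1)=0$. Under (i), (ii) its eigenvalues are real and form an infinite increasing sequence $\lambda_1<\lambda_2<\cdots$ with $\lambda_n\to+\infty$; to each $\lambda_n$ corresponds exactly one (up to sign) normalized eigenfunction $\phi_n\in D\cap C^2([0,1])$, $A\phi_n=\lambda_n\phi_n$, and $\{\phi_n\}_{n\ge1}$ is an orthonormal basis of $L^2_r([0,1])$. Problem (E): the PDE $$\frac{\partial x}{\partial t}(t,z)=\frac{p(z)}{r(z)}\frac{\partial^2 x}{\partial z^2}(t,z)+\frac{p'(z)}{r(z)}\frac{\partial x}{\partial z}(t,z)-\frac{q(z)}{r(z)}x(t,z)+u(t,z),\quad (t,z)\in(0,+\infty)\times(0,1),$$ with boundary conditions, for all $t\ge0$, $g_0x(t,0)+v_0\frac{\partial x}{\partial z}(t,0)=d_0(t)$ and $g_1x(t,1)+v_1\frac{\partial x}{\partial z}(t,1)=d_1(t)$. A solution with initial condition $x_0$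 is a function $x\in C^0(\mathbb{R}_+\times[0,1])\cap C^1((0,+\infty)\times[0,1])$ satisfying these, with $x[t]\in C^2([0,1])$ for all $t\ge0$ and $x(0,z)=x_0(z)$ for all $z\in[0,1]$. For $x_0\in C^2([0,1])$ and $u\in C^1(\mathbb{R}_+\times[0,1])$, $\Phi(x_0,u)\subseteq C^1(\mathbb{R}_+;\mathbb{R}^2)$ denotes the (non-empty) set of pairs $(d_0,d_1)$ for which problem (E) with initial condition $x_0$ has a unique solution. (It contains all $(d_0,d_1)\in C^2(\mathbb{R}_+;\mathbb{R}^2)$ with $d_0(0)=g_0x_0(0)+v_0x_0'(0)$, $d_1(0)=g_1x_0(1)+v_1x_0'(1)$.) *)

(* Defs.v *)
From HB Require Import structures.
From mathcomp Require Import all_boot all_order all_algebra.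
From mathcomp Require Import all_classical all_reals all_analysis.
Import Order.TTheory GRing.Theory Num.Theory.
Import numFieldNormedType.Exports.

Set Implicit Arguments.
Unset Strict Implicit.
Unset Printing Implicit Defensive.

Local Open Scope classical_set_scope.
Local Open Scope ring_scope.

(* A function on an interval I is represented by a total function R -> R whose
   values outside I are irrelevant: every notion below only reads values on I.
   In particular derivatives are taken along I, hence are one-sided at the
   endpoints that belong to I. *)
Definition derivable_on (R : realType) (I : set R) (f : R -> R) (z : R) : Prop :=
  cvg ((fun y => (f y - f z) / (y - z)) @ within I z^').

Definition deriv_on (R : realType) (I : set R) (f : R -> R) (z : R) : R :=
  lim ((fun y => (f y - f z) / (y - z)) @ within I z^').

Definition C0_on (R : realType) (I : set R) (f : R -> R) : Prop :=
  {within I, continuous f}.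

Definition C1_on (R : realType) (I : set R) (f : R -> R) : Prop :=
  [/\ C0_on I f,
      forall z, I z -> derivable_on I f z
    & C0_on I (deriv_on I f)].

Definition C2_on (R : realType) (I : set R) (f : R -> R) : Prop :=
  C1_on I f /\ C1_on I (deriv_on I f).

Definition C0_on2 (R : realType) (I J : set R) (f : R -> R -> R) : Prop :=
  {within I `*` J, continuous (fun tz : R * R => f tz.1 tz.2)}.

Definition C1_on2 (R : realType) (I J : set R) (f : R -> R -> R) : Prop :=
  [/\ C0_on2 I J f,
      forall t z, I t -> J z -> derivable_on I (f^~ z) t,
      forall t z, I t -> J z -> derivable_on J (f t) z,
      C0_on2 I J (fun t z => deriv_on I (f^~ z) t)
    & C0_on2 I J (fun t z => deriv_on J (f t) z)].

(* Used for functions continuous on a compact A, where it is the maximum. *)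
Definition max_on (R : realType) (A : set R) (f : R -> R) : R := sup (f @` A).

Section SturmLiouville.
Context {R : realType}.
Implicit Types (p r q f : R -> R) (g v : R).

Let mu := @lebesgue_measure R.

Definition I01 : set R := `[0, 1].
Definition D01 f : R -> R := deriv_on I01 f.

Definition norm2 r f : R :=
  Num.sqrt (\int[mu]_(z in I01) (r z * `|f z| ^+ 2))%R.

(* The class in H^2(0,1) is represented by its C^1 representative: f' is
   absolutely continuous with a square integrable derivative g. *)
Definition H2 f : Prop :=
  C1_on I01 f /\
  exists g : R -> R,
    [/\ measurable_fun I01 g,
        mu.-integrable I01 (fun z => (`|g z| ^+ 2)%:E)
      & forall z, I01 z ->
          D01 f z = D01 f 0 + (\int[mu]_(s in `[0, z]) g s)%R].

Definition bc0 g0 v0 f : R := g0 * f 0 + v0 * D01 f 0.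
Definition bc1 g1 v1 f : R := g1 * f 1 + v1 * D01 f 1.

Definition SLdom g0 v0 g1 v1 f : Prop :=
  [/\ H2 f, bc0 g0 v0 f = 0 & bc1 g1 v1 f = 0].

(* For f in H^2(0,1) the derivative of p * f' exists almost everywhere. *)
Definition SLop p r q f (z : R) : R :=
  - (r z)^-1 * D01 (fun y => p y * D01 f y) z + q z / r z * f z.

Definition SLeigenfunction p r q g0 v0 g1 v1 (l : R) f : Prop :=
  [/\ SLdom g0 v0 g1 v1 f,
      exists2 z, I01 z & f z != 0
    & {ae mu, forall z, I01 z -> SLop p r q f z = l * f z}].

Definition SLeigenvalue p r q g0 v0 g1 v1 (l : R) : Prop :=
  exists f, SLeigenfunction p r q g0 v0 g1 v1 l f.

(* Indices are shifted: lam n and phi n stand for lambda_{n+1} and phi_{n+1}. *)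
Definition SLspectrum p r q g0 v0 g1 v1 (lam : nat -> R) (phi : nat -> R -> R)
    : Prop :=
  [/\ forall m n, (m < n)%N -> lam m < lam n,
      forall l, SLeigenvalue p r q g0 v0 g1 v1 l <-> exists n, lam n = l
    & forall n, [/\ SLeigenfunction p r q g0 v0 g1 v1 (lam n) (phi n),
                    C2_on I01 (phi n)
                  & norm2 r (phi n) = 1]].

(* The stationary problem (p f')' - q f = 0 with boundary data a and b. *)
Definition SLbvp p q g0 v0 g1 v1 (a b : R) f : Prop :=
  [/\ C2_on I01 f,
      forall z, I01 z -> D01 (fun y => p y * D01 f y) z - q z * f z = 0,
      bc0 g0 v0 f = a
    & bc1 g1 v1 f = b].

Definition SLbvp_unique p q g0 v0 g1 v1 (a b : R) f : Prop :=
  SLbvp p q g0 v0 g1 v1 a b f /\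
  forall h, SLbvp p q g0 v0 g1 v1 a b h -> forall z, I01 z -> h z = f z.

Definition Rplus : set R := `[0, +oo[.
Definition Rpos : set R := `]0, +oo[.

Definition solE p r q g0 v0 g1 v1 (x0 : R -> R) (u : R -> R -> R)
    (d0 d1 : R -> R) (x : R -> R -> R) : Prop :=
  [/\ C0_on2 Rplus I01 x /\ C1_on2 Rpos I01 x,
      forall t, 0 <= t -> C2_on I01 (x t),
      forall t z, 0 < t -> 0 < z < 1 ->
        deriv_on Rpos (x^~ z) t =
          p z / r z * D01 (D01 (x t)) z + D01 p z / r z * D01 (x t) z
          - q z / r z * x t z + u t z,
      forall t, 0 <= t -> bc0 g0 v0 (x t) = d0 t /\ bc1 g1 v1 (x t) = d1 t
    & forall z, I01 z -> x 0 z = x0 z].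

Definition Phi p r q g0 v0 g1 v1 (x0 : R -> R) (u : R -> R -> R)
    : set ((R -> R) * (R -> R)) :=
  [set d | [/\ C1_on Rplus d.1, C1_on Rplus d.2
    & exists x, solE p r q g0 v0 g1 v1 x0 u d.1 d.2 x /\
        forall y, solE p r q g0 v0 g1 v1 x0 u d.1 d.2 y ->
          forall t z, 0 <= t -> I01 z -> y t z = x t z]].

Definition termC0 g0 v0 (lam : nat -> R) (phi : nat -> R -> R) : R ^nat :=
  fun n => (lam n ^+ 2)^-1 * `|g0 * D01 (phi n) 0 - v0 * phi n 0| ^+ 2.
Definition termC1 g1 v1 (lam : nat -> R) (phi : nat -> R -> R) : R ^nat :=
  fun n => (lam n ^+ 2)^-1 * `|v1 * phi n 1 - g1 * D01 (phi n) 1| ^+ 2.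
Definition termCt r (lam : nat -> R) (phi : nat -> R -> R) : R ^nat :=
  fun n => (lam n ^+ 2)^-1 * (\int[mu]_(z in I01) (r z * `|phi n z|))%R ^+ 2.

Definition const0 p g0 v0 lam phi : R :=
  p 0 / (g0 ^+ 2 + v0 ^+ 2)
  * Num.sqrt (limn (series (termC0 g0 v0 lam phi))).
Definition const1 p g1 v1 lam phi : R :=
  p 1 / (g1 ^+ 2 + v1 ^+ 2)
  * Num.sqrt (limn (series (termC1 g1 v1 lam phi))).
Definition constt r lam phi : R :=
  Num.sqrt (limn (series (termCt r lam phi))).

End SturmLiouville.

(* Main.v *)
Require Import Defs.
From mathcomp Require Import all_boot all_order all_algebra.
From mathcomp Require Import all_classical all_reals all_analysis.
From mathcomp Require Import measurable_realfun ring lra.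
Import Order.TTheory GRing.Theory Num.Theory.
Import numFieldNormedType.Exports.
Set Implicit Arguments.
Unset Strict Implicit.
Unset Printing Implicit Defensive.
Local Open Scope classical_set_scope.
Local Open Scope ring_scope.

(** Write <f, g> for the inner product of L^2_r, A for the Sturm-Liouville
  operator and c_n(t) for <x[t], phi_n>.  Green's identity moves A from x[t] to
  phi_n and leaves boundary terms that only involve d_0 and d_1, so that
    c_n' = - lambda_n c_n + beta1_n d_1 + beta0_n d_0 + <u[t], phi_n>
  ([fourier_equation]).  With e = exp(- lambda_n t), an integrating factor gives
  |c_n(t)| <= e |c_n(0)| + (1 - e) M_n / lambda_n, where M_n bounds the source
  on [0, t] ([scalar_decay]).  The square of the right-hand side is at most
  e / (2 - e) c_n(0)^2 + (M_n / lambda_n)^2 ([decay_square]), and two Young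
  inequalities with weights eps and omega separate d_0, d_1 and u.  Summing over
  n, with Parseval's identity at time t and Bessel's inequality at time 0, gives
  the estimate ([iss_estimate]).  The same identity applied to the stationary
  solutions expresses their coefficients through beta0_n and beta1_n, and
  Parseval turns the series in the gain constants into norms
  ([stationary_constant]).

  The analytic core is Parseval's identity for C^2 functions ([parseval]), that
  is, the completeness of the eigenfunctions.  It uses neither compact operators
  nor an abstract spectral theorem.  Two facts about the differential equation carry
  it.  Initial value problems are solvable, by Picard iteration
  ([linear_system_solution]), and solutions with zero initial data are bounded
  by the L^2_r norm of the source, by Gronwall ([SLsol_gronwall]).  Shooting
  from the left endpoint then shows that for every real l, eigenvalue or not,
  A - l is bounded below on the functions of its domain that are orthogonal to
  all phi_n ([resolvent_bound]).  If h is a nonzero function orthogonal to all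
  phi_n, the power method applied to A^-1 and h produces approximate
  eigenvectors of A^-2 orthogonal to all phi_n, which contradicts these lower
  bounds; hence h = 0 ([SLorth_eq0]).

  For f in the domain of A, the summability of max|phi_n| / lambda_n makes the
  expansion of f converge uniformly, and completeness identifies its sum with f
  ([remainder_dom]).  A cutoff at both endpoints moves a general C^2 function
  into the domain at an arbitrarily small cost in norm. *)


(** * Derivatives along a set *)

Section RelativeDerivative.
Context {R : realType}.
Implicit Types (I J : set R) (f g : R -> R) (z d e : R).

(** A relational form of [deriv_on]: derivatives are then obtained by rules
  instead of by evaluating a limit. *)
Definition is_D I f z d : Prop :=
  (fun y => (f y - f z) / (y - z)) @ within I z^' --> d.

Lemma derivable_on_is_D I f z :
  derivable_on I f z -> is_D I f z (deriv_on I f z).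
Proof. by []. Qed.

Lemma is_D_deriv_on I f z d : ProperFilter (within I z^') ->
  is_D I f z d -> derivable_on I f z /\ deriv_on I f z = d.
Proof.
move=> PF fd; split; first exact: (cvgP d).
exact: cvg_lim.
Qed.

(** The form without division has no exceptional point y = z. *)
Lemma is_DP I f z d : is_D I f z d <->
  forall eps : R, 0 < eps -> exists2 del : R, 0 < del & forall y, I y ->
    `|y - z| < del -> `|f y - f z - d * (y - z)| <= eps * `|y - z|.
Proof.
split.
  move=> /cvgrPdist_le fd eps eps0.
  have /nbhs_ballP[del /= del0 h] := fd _ eps0.
  exists del => // y Iy yz.
  have [->|yz0] := eqVneq y z; first by rewrite !subrr mulr0 subr0 !normr0 mulr0.
  have := h y; rewrite /ball /= distrC => /(_ yz yz0 Iy).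
  have yz1 : y - z != 0 by rewrite subr_eq0.
  have -> : f y - f z - d * (y - z) = - ((d - (f y - f z) / (y - z)) * (y - z)).
    by field.
  rewrite normrN normrM => /ler_wpM2r; apply.
  exact: normr_ge0.
move=> h; apply/cvgrPdist_le => eps eps0.
have [del del0 hd] := h _ eps0.
apply/nbhs_ballP; exists del => //= y; rewrite /ball /= distrC => yz yz0 Iy.
have yz1 : y - z != 0 by rewrite subr_eq0.
have := hd y Iy yz.
rewrite -ler_pdivrMr ?normr_gt0// -normfV -normrM.
congr (_ <= _); rewrite -normrN; congr (`|_|); field.
exact: yz1.
Qed.

Lemma is_D_sub I J f z d : J `<=` I -> is_D I f z d -> is_D J f z d.
Proof.
move=> JI /is_DP h; apply/is_DP => e e0; have [del d0 hd] := h e e0.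
by exists del => // y /JI Iy; exact: hd.
Qed.

Lemma is_D_ext I f g z d : I z -> (forall y, I y -> f y = g y) ->
  is_D I f z d -> is_D I g z d.
Proof.
move=> Iz fg /is_DP h; apply/is_DP => e e0; have [del d0 hd] := h e e0.
by exists del => // y Iy; rewrite -!fg//; exact: hd.
Qed.

Lemma is_D_cvg I f z d : is_D I f z d -> f @ within I (nbhs z) --> f z.
Proof.
move=> /is_DP h; apply/cvgrPdist_le => e e0.
have [del d0 hd] := h _ (@ltr01 R).
pose m := Num.min del (e / (1 + `|d|)).
have D0 : 0 < 1 + `|d| by rewrite ltr_pwDl.
have m0 : 0 < m by rewrite lt_min d0 divr_gt0.
apply/nbhs_ballP; exists m => //= y; rewrite /ball/= distrC lt_min => /andP[y1 y2] Iy.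
have := hd y Iy y1; rewrite mul1r => hy.
rewrite distrC -(subrK (d * (y - z)) (f y - f z)) (le_trans (ler_normD _ _))//.
rewrite normrM (le_trans (lerD hy (lexx _)))//.
rewrite -{1}(mul1r `|y - z|) -mulrDl mulrC -ler_pdivlMr//.
exact: ltW.
Qed.

Lemma is_D_cst I c z : is_D I (fun=> c) z 0.
Proof.
by apply/is_DP => e e0; exists 1 => // y _ _; rewrite subrr mul0r subr0 normr0 mulr_ge0// ltW.
Qed.

Lemma is_D_id I z : is_D I id z 1.
Proof.
by apply/is_DP => e e0; exists 1 => // y _ _; rewrite mul1r subrr normr0 mulr_ge0// ltW.
Qed.

Lemma is_DD I f g z d e : is_D I f z d -> is_D I g z e ->
  is_D I (fun y => f y + g y) z (d + e).
Proof.
move=> fd ge; rewrite /is_D.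
under eq_fun => y do rewrite opprD addrACA mulrDl.
exact: cvgD.
Qed.

Lemma is_DM I f g z d e : is_D I f z d -> is_D I g z e ->
  is_D I (fun y => f y * g y) z (d * g z + f z * e).
Proof.
move=> fd ge; rewrite /is_D.
have -> : (fun y => (f y * g y - f z * g z) / (y - z)) =
  (fun y => (f y - f z) / (y - z) * g y + f z * ((g y - g z) / (y - z))).
  apply/funext => y; rewrite mulrAC (mulrA (f z)) -mulrDl; congr (_ / _); ring.
apply: cvgD; apply: cvgM => //; last exact: cvg_cst.
apply: cvg_trans (is_D_cvg ge); apply: cvg_app.
by move=> A; exact: nbhs_dnbhs.
Qed.

Lemma is_DV I f z d : f z != 0 -> is_D I f z d ->
  is_D I (fun y => (f y)^-1) z (- d / f z ^+ 2).
Proof.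
move=> fz0 fd; rewrite /is_D.
have fc := is_D_cvg fd.
have fc' : f @ within I z^' --> f z.
  by apply: cvg_trans fc; apply: cvg_app => A; exact: nbhs_dnbhs.
have : (fun y => - ((f y - f z) / (y - z)) / (f y * f z)) @ within I z^'
    --> - d / (f z * f z).
  apply: cvgM; first exact: cvgN.
  apply: cvgV; first by rewrite mulf_neq0.
  by apply: cvgM => //; exact: cvg_cst.
rewrite -expr2; apply: cvg_trans; apply: near_eq_cvg.
have : \forall y \near within I z^', f y != 0.
  exact: cvgr_neq0 fc' fz0.
apply: filterS => y fy0.
have [->|yz] := eqVneq y z; first by rewrite !subrr !mul0r oppr0 mul0r.
by field; rewrite fy0 fz0 subr_eq0 yz.
Qed.

Lemma is_DN I f z d : is_D I f z d -> is_D I (fun y => - f y) z (- d).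
Proof.
move=> fd; rewrite /is_D.
under eq_fun => y do rewrite -opprD mulNr.
exact: cvgN.
Qed.

Lemma is_DB I f g z d e : is_D I f z d -> is_D I g z e ->
  is_D I (fun y => f y - g y) z (d - e).
Proof. by move=> fd ge; apply: is_DD => //; exact: is_DN. Qed.

Lemma is_DZ I f z c d : is_D I f z d -> is_D I (fun y => c * f y) z (c * d).
Proof.
move=> fd; rewrite -[c * d]add0r -[X in X + _](mul0r (f z)).
by apply: is_DM => //; exact: is_D_cst.
Qed.

Lemma is_D_nbhs I f z d : nbhs z I -> is_D I f z d ->
  (fun h => h^-1 *: ((f \o shift z) (h *: (1 : R)) - f z)) @ 0^' --> d.
Proof.
move=> /nbhs_ballP[rho /= rho0 hI] /cvgrPdist_le h; apply/cvgrPdist_le => e e0.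
have /nbhs_ballP[del /= del0 hd] := h e e0.
apply/nbhs_ballP; exists (Num.min rho del); first by rewrite /= lt_min rho0.
move=> t /=; rewrite /ball/= sub0r normrN lt_min => /andP[t1 t2] t0.
have bz x : `|t| < x -> `|z - (t + z)| < x by rewrite opprD addrCA subrr addr0 normrN.
have := hd (t + z); rewrite /ball/= => /(_ (bz _ t2)).
have -> : t + z != z by rewrite -subr_eq0 addrK.
move=> /(_ erefl (hI _ (bz _ t1))).
by rewrite addrK [t *: _]mulr1 mulrC.
Qed.

Lemma is_D_is_derive I f z d : nbhs z I -> is_D I f z d ->
  is_derive z 1 f d.
Proof.
move=> nI h; have := is_D_nbhs nI h => h'.
by apply: DeriveDef; [exact: (cvgP d)|exact: cvg_lim].
Qed.

Lemma is_derive_is_D I f z d : is_derive z 1 f d -> is_D I f z d.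
Proof.
move=> [df <-]; apply: (@is_D_sub setT) => //.
have h : (fun h => h^-1 *: ((f \o shift z) (h *: (1 : R)) - f z)) @ 0^' --> 'D_1 f z by [].
move/cvgrPdist_le : h => h; apply/cvgrPdist_le => e e0.
have /nbhs_ballP[del /= del0 hd] := h e e0.
apply/nbhs_ballP; exists del => //= y; rewrite /ball/= distrC => yz yz0 _.
have := hd (y - z); rewrite /ball/= sub0r normrN => /(_ yz).
rewrite subr_eq0 => /(_ yz0).
by rewrite [_ *: 1]mulr1 subrK [_ *: _]mulrC.
Qed.

(** The mean value theorem reads the derivative at interior points only, where
  the choice of the ambient set is immaterial. *)
Lemma is_D_le0_nincr I f f' (a b : R) : a <= b -> `[a, b] `<=` I ->
  (forall z, a <= z <= b -> f @ within I (nbhs z) --> f z) ->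
  (forall z, a < z < b -> is_D `]a, b[ f z (f' z)) ->
  (forall z, a < z < b -> f' z <= 0) -> f b <= f a.
Proof.
move=> ab abI fc fd f'0.
have df z : z \in `]a, b[ -> is_derive z 1 f (f' z).
  move=> zin; have zab : a < z < b by move: zin; rewrite in_itv.
  by apply: (@is_D_is_derive `]a, b[); [exact: near_in_itvoo zin|exact: fd].
apply: (@ler0_derive1_le_cc _ f a b) => //.
- by move=> x /df [].
- move=> x xab; have [h1 h2] := df x xab; rewrite derive1E h2 f'0//.
- apply/subspace_continuousP => z; rewrite /= in_itv /= => zab.
  apply: cvg_trans (fc z zab); apply: cvg_app.
  exact: within_subset abI.
- by rewrite in_itv /= lexx ab.
- by rewrite in_itv /= lexx ab.
Qed.

End RelativeDerivative.

(** * Calculus on the unit interval *)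

Section UnitInterval.
Context {R : realType}.
Implicit Types (I J : set R) (f g : R -> R) (z d e : R).
Let mu := @lebesgue_measure R.
Local Notation I01 := (@I01 R).

Lemma I01E z : I01 z = (0 <= z <= 1) :> Prop.
Proof. by rewrite /Defs.I01 /= in_itv. Qed.

Lemma I01_0 : I01 0. Proof. by rewrite I01E lexx ler01. Qed.
Lemma I01_1 : I01 1. Proof. by rewrite I01E lexx ler01. Qed.

Lemma C0_onP I f :
  C0_on I f <-> forall z, I z -> f @ within I (nbhs z) --> f z.
Proof. exact: subspace_continuousP. Qed.

Lemma C0_on_ext I f g : (forall z, I z -> f z = g z) -> C0_on I f -> C0_on I g.
Proof.
by move=> fg; apply: subspace_eq_continuous => z; rewrite inE; exact: fg.
Qed.

Lemma C0_on_cst I (c : R) : C0_on I (fun=> c).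
Proof. by apply/C0_onP => z _; exact: cvg_cst. Qed.

Lemma C0_onD I f g : C0_on I f -> C0_on I g -> C0_on I (fun z => f z + g z).
Proof.
by move=> /C0_onP fc /C0_onP gc; apply/C0_onP => z Iz; apply: cvgD; auto.
Qed.

Lemma C0_onM I f g : C0_on I f -> C0_on I g -> C0_on I (fun z => f z * g z).
Proof.
by move=> /C0_onP fc /C0_onP gc; apply/C0_onP => z Iz; apply: cvgM; auto.
Qed.

Lemma C0_onN I f : C0_on I f -> C0_on I (fun z => - f z).
Proof. by move=> /C0_onP fc; apply/C0_onP => z Iz; apply: cvgN; auto. Qed.

Lemma C0_onB I f g : C0_on I f -> C0_on I g -> C0_on I (fun z => f z - g z).
Proof. by move=> fc gc; apply: C0_onD => //; exact: C0_onN. Qed.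

Lemma C0_on_normr I f : C0_on I f -> C0_on I (fun z => `|f z|).
Proof. by move=> /C0_onP fc; apply/C0_onP => z Iz; apply: cvg_norm; auto. Qed.

Lemma C0_onX I f n : C0_on I f -> C0_on I (fun z => f z ^+ n).
Proof.
move=> fc; elim: n => [|n IH]; first by under eq_fun do rewrite expr0; exact: C0_on_cst.
under eq_fun do rewrite exprS; exact: C0_onM.
Qed.

Lemma C0_onV I f : (forall z, I z -> f z != 0) -> C0_on I f ->
  C0_on I (fun z => (f z)^-1).
Proof. by move=> f0 /C0_onP fc; apply/C0_onP => z Iz; apply: cvgV; auto. Qed.

Lemma C0_on_sub I J f : J `<=` I -> C0_on I f -> C0_on J f.
Proof. by move=> JI; exact: continuous_subspaceW. Qed.

Lemma is_D_C0_on I f f' : (forall z, I z -> is_D I f z (f' z)) -> C0_on I f.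
Proof. by move=> fd; apply/C0_onP => z Iz; exact: is_D_cvg (fd z Iz). Qed.

Lemma C0_on_bounded (a b : R) f : C0_on `[a, b] f ->
  exists2 M : R, 0 < M & forall z, a <= z <= b -> `|f z| <= M.
Proof.
move=> fc.
have /compact_bounded[M [_ mrt]] := continuous_compact fc (@segment_compact _ a b).
exists (`|M| + 1); first by rewrite ltr_pwDr.
move=> z zab; apply: mrt; first by rewrite (le_lt_trans (ler_norm M))// ltrDl.
by exists z => //=; rewrite in_itv.
Qed.

Lemma C0_on_integrable (a b : R) f : C0_on `[a, b] f ->
  mu.-integrable `[a, b] (EFin \o f).
Proof. by move=> fc; apply: continuous_compact_integrable => //; exact: segment_compact. Qed.

Lemma measurable_I01 : measurable (I01 : set (measurableTypeR R)).
Proof. exact: measurable_itv. Qed.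

Lemma integrable_I01 f : C0_on I01 f -> mu.-integrable I01 (EFin \o f).
Proof. exact: C0_on_integrable. Qed.

Lemma within_I01_proper z : I01 z -> ProperFilter (within I01 z^').
Proof.
rewrite I01E => /andP[z0 z1]; apply: Build_ProperFilter_ex.
move=> P /nbhs_ballP[e /= e0 h].
pose m := Num.min (e / 2) (1 / 2).
have m0 : 0 < m by rewrite lt_min !divr_gt0.
have me : m < e by rewrite gt_min; apply/orP; left; lra.
have m1 : m <= 1 / 2 by rewrite ge_min lexx orbT.
have [zh|zh] := leP z (1 / 2).
  exists (z + m); apply: h.
  - by rewrite /ball/= opprD addrA subrr sub0r normrN gtr0_norm.
  - by apply/eqP => h'; lra.
  - by rewrite I01E; lra.
exists (z - m); apply: h.
- by rewrite /ball/= opprB addrC subrK gtr0_norm.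
- by apply/eqP => h'; lra.
- by rewrite I01E; lra.
Qed.

Lemma is_D_unique f z d e : I01 z -> is_D I01 f z d -> is_D I01 f z e -> d = e.
Proof.
by move=> /within_I01_proper PF fd fe; apply: cvg_unique fd fe.
Qed.

Lemma is_D_D01 f z d : I01 z -> is_D I01 f z d -> D01 f z = d.
Proof.
by move=> /within_I01_proper PF fd; apply: (is_D_deriv_on PF fd).2.
Qed.

Lemma C1_on_is_D f z : C1_on I01 f -> I01 z -> is_D I01 f z (D01 f z).
Proof. by move=> [_ fd _] Iz; exact/derivable_on_is_D/fd. Qed.

Lemma is_D_C1_on f f' : (forall z, I01 z -> is_D I01 f z (f' z)) ->
  C0_on I01 f' -> C1_on I01 f.
Proof.
move=> fd fc'; split; first exact: is_D_C0_on fd.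
  by move=> z Iz; apply: (is_D_deriv_on (within_I01_proper Iz) (fd z Iz)).1.
by apply: C0_on_ext fc' => z Iz; rewrite [RHS](is_D_D01 Iz (fd z Iz)).
Qed.

Lemma is_D_nincr01 f f' (a b : R) : 0 <= a -> a <= b -> b <= 1 ->
  (forall z, I01 z -> is_D I01 f z (f' z)) ->
  (forall z, I01 z -> f' z <= 0) -> f b <= f a.
Proof.
move=> a0 ab b1 fd f0.
have sub z : a <= z <= b -> I01 z by move=> ?; rewrite I01E; lra.
apply: (is_D_le0_nincr (I := I01) (f' := f') ab).
- by move=> z; rewrite /= in_itv /=; exact: sub.
- by move=> z /sub Iz; exact: is_D_cvg (fd z Iz).
- move=> z zab; have Iz : I01 z by apply: sub; lra.
  apply: is_D_sub (fd z Iz) => y; rewrite /= in_itv /= => yab; apply: sub; lra.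
- by move=> z zab; apply: f0; apply: sub; lra.
Qed.

Lemma is_D0_cst f z : (forall z, I01 z -> is_D I01 f z 0) -> I01 z -> f z = f 0.
Proof.
move=> fd; rewrite I01E => /andP[z0 z1]; apply/eqP; rewrite eq_le; apply/andP; split.
  exact: (is_D_nincr01 (f' := fun=> 0)).
rewrite -lerN2; apply: (is_D_nincr01 (f := fun x => - f x) (f' := fun=> 0)) => // y Iy.
by rewrite -oppr0; exact/is_DN/fd.
Qed.

Lemma is_D_unique01 f g f' z : f 0 = g 0 ->
  (forall z, I01 z -> is_D I01 f z (f' z)) ->
  (forall z, I01 z -> is_D I01 g z (f' z)) -> I01 z -> f z = g z.
Proof.
move=> fg0 fd gd Iz; apply/eqP; rewrite -subr_eq0.
rewrite (is_D0_cst (f := fun z => f z - g z) _ Iz) ?fg0 ?subrr// => y Iy.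
by rewrite -(subrr (f' y)); apply: is_DB; auto.
Qed.

(** The primitive of f is differentiable up to the endpoints, because f
  extends continuously to the line through the retraction of the line onto
  the unit interval. *)
Lemma is_D_primitive f z : C0_on I01 f -> I01 z ->
  is_D I01 (fun x => \int[mu]_(s in `[0, x]) f s)%R z (f z).
Proof.
move=> fc Iz.
pose c (x : R) := Num.max 0 (Num.min x 1).
have cI x : I01 (c x).
  by rewrite I01E /c le_max lexx /= ge_max ler01 ge_min lexx orbT.
have cE x : I01 x -> c x = x.
  by rewrite I01E => /andP[x0 x1]; rewrite /c min_l// max_r.
have cc : continuous c.
  move=> x; apply: (@continuous_max R R^o (fun=> 0) (fun x => Num.min x 1)).
    exact: cvg_cst.
  by apply: (@continuous_min R R^o (fun x => x) (fun=> 1)); [exact: cvg_id|exact: cvg_cst].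
pose h x := f (c x).
have hc : continuous h.
  move=> x; move/C0_onP : fc => /(_ _ (cI x)) fc A /fc hA.
  have : nbhs x (c @^-1` [set y | I01 y -> A (f y)]) := cc x _ hA.
  by apply: filterS => y; exact.
have hint : mu.-integrable `[-1, 2] (EFin \o h).
  apply: C0_on_integrable; exact: continuous_subspaceT.
pose G x := (\int[mu]_(s in `[(-1)%R, x]) h s)%R.
have GD x : I01 x -> is_D I01 G x (h x).
  move=> Ix; apply: is_derive_is_D; have := Ix; rewrite I01E => x01.
  have x2 : x < 2 by lra.
  have x1 : -1 < x by lra.
  have [d1 d2] := continuous_FTC1_closed x2 hint x1 (hc x).
  by apply: DeriveDef => //; rewrite -derive1E.
have GE x : I01 x -> G x - G 0 = (\int[mu]_(s in `[0, x]) f s)%R.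
  move=> Ix; have := Ix; rewrite I01E => /andP[x0 x1].
  have hx : mu.-integrable `[-1, x] (EFin \o h).
    apply: integrableS hint => //; apply: subset_itvl; rewrite bnd_simp; lra.
  rewrite /G Rintegral_itvB//; last by rewrite bnd_simp; lra.
  rewrite Rintegral_itv_obnd_cbnd; last first.
    apply: integrableS hx => //; apply: subset_itvr; rewrite bnd_simp; lra.
  apply: eq_Rintegral => s; rewrite inE /= in_itv /= => /andP[s0 sx].
  by rewrite /h cE// I01E; lra.
have -> : f z = h z - 0 by rewrite /h cE// subr0.
apply: (is_D_ext Iz GE); apply: is_DB; first exact: GD.
exact: is_D_cst.
Qed.

Definition J f : R := (\int[mu]_(s in I01) f s)%R.

Lemma J_FTC f f' : (forall z, I01 z -> is_D I01 f z (f' z)) -> C0_on I01 f' ->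
  J f' = f 1 - f 0.
Proof.
move=> fd fc.
have := is_D_unique01 (f := fun x => (\int[mu]_(s in `[0%R, x]) f' s)%R)
  (g := fun x => f x - f 0) (f' := f') (z := 1).
rewrite set_itv1 Rintegral_set1 subrr => /(_ erefl) h; rewrite [LHS]h//; last exact: I01_1.
- by move=> z Iz; exact: is_D_primitive.
- move=> z Iz; rewrite -[f' z]subr0; apply: is_DB; first exact: fd.
  exact: is_D_cst.
Qed.

Lemma eq_J f g : (forall z, I01 z -> f z = g z) -> J f = J g.
Proof. by move=> fg; apply: eq_Rintegral => z; rewrite inE; exact: fg. Qed.

Lemma J_D f g : C0_on I01 f -> C0_on I01 g -> J (fun z => f z + g z) = J f + J g.
Proof.
by move=> fc gc; apply: RintegralD;
  solve [exact: measurable_I01|exact: integrable_I01|by []].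
Qed.

Lemma J_Z c f : C0_on I01 f -> J (fun z => c * f z) = c * J f.
Proof.
by move=> fc; apply: RintegralZl;
  solve [exact: measurable_I01|exact: integrable_I01|by []].
Qed.

Lemma J_B f g : C0_on I01 f -> C0_on I01 g -> J (fun z => f z - g z) = J f - J g.
Proof.
by move=> fc gc; apply: RintegralB;
  solve [exact: measurable_I01|exact: integrable_I01|by []].
Qed.

Lemma J_cst c : J (fun=> c) = c.
Proof.
rewrite (J_FTC (f := fun z => c * z)); first by rewrite mulr1 mulr0 subr0.
  by move=> z _; rewrite -{2}[c]mulr1; apply: is_DZ; exact: is_D_id.
exact: C0_on_cst.
Qed.

Lemma le_J f g : C0_on I01 f -> C0_on I01 g ->
  (forall z, I01 z -> f z <= g z) -> J f <= J g.
Proof.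
by move=> fc gc fg; apply: le_Rintegral;
  solve [exact: measurable_I01|exact: integrable_I01|by []].
Qed.

Lemma J_ge0 f : (forall z, I01 z -> 0 <= f z) -> 0 <= J f.
Proof. by move=> f0; exact: Rintegral_ge0. Qed.

Lemma le_norm_J f : C0_on I01 f -> `|J f| <= J (fun z => `|f z|).
Proof.
by move=> fc; apply: le_normr_Rintegral;
  solve [exact: measurable_I01|exact: integrable_I01|by []].
Qed.

(** A primitive of f is monotone with equal values at both endpoints, hence
  constant, so its derivative f vanishes. *)
Lemma J_eq0 f : C0_on I01 f -> (forall z, I01 z -> 0 <= f z) -> J f = 0 ->
  forall z, I01 z -> f z = 0.
Proof.
move=> fc f0 Jf z Iz.
pose F x := (\int[mu]_(s in `[0%R, x]) f s)%R.
have FD x : I01 x -> is_D I01 F x (f x) by exact: is_D_primitive.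
have F0 : F 0 = 0 by rewrite /F set_itv1 Rintegral_set1.
have ND x : I01 x -> is_D I01 (fun x => - F x) x (- f x) by move=> Ix; exact/is_DN/FD.
have Nf x : I01 x -> - f x <= 0 by move=> Ix; rewrite oppr_le0 f0.
have FE x : I01 x -> 0 = F x.
  move=> Ix; have := Ix; rewrite I01E => /andP[x0 x1].
  have := is_D_nincr01 (lexx 0) x0 x1 ND Nf.
  have := is_D_nincr01 x0 x1 (lexx 1) ND Nf.
  by rewrite F0 [F 1]Jf; lra.
apply: (is_D_unique Iz (FD z Iz)).
apply: (is_D_ext Iz FE); exact: is_D_cst.
Qed.

Lemma max_on_ge (a b : R) (f : R -> R) z : C0_on `[a, b] f -> a <= z <= b ->
  f z <= max_on `[a, b] f.
Proof.
move=> fc zab; have [M _ hM] := C0_on_bounded fc.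
apply: ub_le_sup; last by exists z => //=; rewrite in_itv.
exists M => _ [x /= + <-]; rewrite in_itv /= => xab.
by rewrite (le_trans (ler_norm _))// hM.
Qed.

End UnitInterval.

Arguments C0_on_cst {R} I c.

(** * Uniform limits and linear differential systems *)

Section UniformLimits.
Context {R : realType}.
Local Notation I01 := (@I01 R).

Lemma series_le_lim (u : R^nat) n : (forall k, 0 <= u k) -> cvgn (series u) ->
  series u n <= limn (series u).
Proof.
move=> u0 uc; apply: nondecreasing_cvgn_le => //.
by apply/nondecreasing_seqP => k; rewrite seriesSr lerDl.
Qed.

(** Weierstrass test, stated for iterates rather than for a series: it serves
  both the Picard iteration and the remainders of eigenfunction expansions. *)
Lemma uniform_limit (f_ : nat -> R -> R) (M : R^nat) :
  (forall n, C0_on I01 (f_ n)) ->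
  (forall n z, I01 z -> `|f_ n.+1 z - f_ n z| <= M n) ->
  cvgn (series M) ->
  exists f (T : R^nat), [/\ C0_on I01 f, T @ \oo --> 0 &
    forall n z, I01 z -> `|f z - f_ n z| <= T n].
Proof.
move=> fc fM Mc.
pose T n := limn (series M) - series M n.
have T0 : T @ \oo --> 0.
  by rewrite -(subrr (limn (series M))); apply: cvgB => //; exact: cvg_cst.
have dist n m z : (n <= m)%N -> I01 z -> `|f_ m z - f_ n z| <= series M m - series M n.
  move=> nm Iz; rewrite -(subnKC nm); elim: (m - n)%N => [|k IH].
    by rewrite addn0 !subrr normr0.
  rewrite addnS seriesSr -(subrK (f_ (n + k)%N z) (f_ (n + k).+1 z)) -addrA.
  rewrite (le_trans (ler_normD _ _))//.
  have := fM (n + k)%N z Iz; lra.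
have fcvg z : I01 z -> cvgn (f_^~ z).
  move=> Iz; pose g k := f_ k.+1 z - f_ k z.
  have gc : cvgn (series g).
    apply: normed_cvg; apply: series_le_cvg Mc; first by move=> n; exact: normr_ge0.
      by move=> n; exact: le_trans (fM n z Iz).
    by move=> n; exact: fM.
  have -> : f_^~ z = (fun n => f_ 0%N z + series g n).
    apply/funext; elim => [|n IH]; first by rewrite /series /= big_geq// addr0.
    by rewrite seriesSr addrA -IH /g addrC subrK.
  apply: is_cvgD => //; exact: is_cvg_cst.
pose f z := limn (f_^~ z).
have fT n z : I01 z -> `|f z - f_ n z| <= T n.
  move=> Iz.
  have c1 : (fun m => `|f_ m z - f_ n z|) @ \oo --> `|f z - f_ n z|.
    by apply: cvg_norm; apply: cvgB; [exact: fcvg|exact: cvg_cst].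
  have c2 : (fun m => series M m - series M n) @ \oo --> T n.
    by apply: cvgB => //; exact: cvg_cst.
  rewrite -(cvg_lim _ c1)// -(cvg_lim _ c2)//.
  apply: ler_lim; [exact: cvgP c1|exact: cvgP c2|].
  by exists n => // m /= nm; exact: dist.
exists f, T; split => //.
apply/C0_onP => z Iz; apply/cvgrPdist_le => e e0.
have e3 : 0 < e / 3 by rewrite divr_gt0.
have [N _ hN] : \forall n \near \oo, `|0 - T n| <= e / 3.
  by move/cvgrPdist_le : T0; apply.
have TN : T N <= e / 3.
  by have := hN N (leqnn N); rewrite /= sub0r normrN => /(le_trans (ler_norm _)).
have := fc N; move/C0_onP => /(_ z Iz) /cvgrPdist_le /(_ _ e3).
apply: filterS2 (withinT _ _) => y Iy h.
rewrite (_ : f z - f y = (f z - f_ N z) + (f_ N z - f_ N y) - (f y - f_ N y)); last by ring.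
rewrite (le_trans (ler_normB _ _))//.
have := ler_normD (f z - f_ N z) (f_ N z - f_ N y).
have := h; have := fT N z Iz; have := fT N y Iy; lra.
Qed.

(** Both d - g and - d - g are nonincreasing.  Bounds on primitives are obtained
  this way, without estimating integrals. *)
Lemma is_D_compare (d d' g g' : R -> R) z :
  (forall z, I01 z -> is_D I01 d z (d' z)) ->
  (forall z, I01 z -> is_D I01 g z (g' z)) ->
  (forall z, I01 z -> `|d' z| <= g' z) -> `|d 0| <= g 0 ->
  I01 z -> `|d z| <= g z.
Proof.
move=> dd gd dg dg0; rewrite I01E => /andP[z0 z1].
have h1 := is_D_nincr01 (lexx 0) z0 z1 (fun y Iy => is_DB (dd y Iy) (gd y Iy)).
have h2 := is_D_nincr01 (lexx 0) z0 z1 (fun y Iy => is_DB (is_DN (dd y Iy)) (gd y Iy)).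
have {}h1 : d z - g z <= d 0 - g 0.
  by apply: h1 => y Iy; have := dg y Iy; rewrite ler_norml => /andP[]; lra.
have {}h2 : - d z - g z <= - d 0 - g 0.
  by apply: h2 => y Iy; have := dg y Iy; rewrite ler_norml => /andP[]; lra.
move: dg0; rewrite !ler_norml => /andP[? ?]; apply/andP; split; lra.
Qed.

Lemma is_D_expR I (k z : R) :
  is_D I (fun x => expR (k * x)) z (k * expR (k * z)).
Proof.
have kD : is_derive z 1 (fun x => k * x) k.
  apply: (@is_D_is_derive _ setT); first exact: filterT.
  by rewrite -{2}[k]mulr1; apply: is_DZ; exact: is_D_id.
apply: is_derive_is_D; rewrite mulrC.
exact: (is_derive1_comp (is_derive_expR (k * z)) kD).
Qed.

Lemma is_D_linear I (k z : R) : is_D I (fun x => k * x) z k.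
Proof. by rewrite -{2}[k]mulr1; apply: is_DZ; exact: is_D_id. Qed.

Let prim (f : R -> R) z := (\int[@lebesgue_measure R]_(s in `[0%R, z]) f s)%R.

(** Picard iteration for a linear system of two equations.  In the weighted
  norm with weight exp(-2Lz) the iteration contracts by 1/2. *)
Lemma linear_system_solution (a b F : R -> R) (y0 w0 : R) :
  C0_on I01 a -> C0_on I01 b -> C0_on I01 F ->
  exists y w, [/\ forall z, I01 z -> is_D I01 y z (a z * w z),
    forall z, I01 z -> is_D I01 w z (b z * y z + F z), y 0 = y0 & w 0 = w0].
Proof.
move=> ac bc Fc.
pose step (yw : (R -> R) * (R -> R)) :=
  (fun z => y0 + prim (fun s => a s * yw.2 s) z,
   fun z => w0 + prim (fun s => b s * yw.1 s + F s) z).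
pose it n := iter n step (fun=> y0, fun=> w0).
pose Y n := (it n).1; pose W n := (it n).2.
have YD0 f c z : C0_on I01 f -> I01 z -> is_D I01 (fun z => c + prim f z) z (f z).
  move=> fc Iz; rewrite -[f z]add0r; apply: is_DD; first exact: is_D_cst.
  exact: is_D_primitive.
have YW_c n : C0_on I01 (Y n) /\ C0_on I01 (W n).
  elim: n => [|n [IY IW]]; first by split; exact: C0_on_cst.
  split.
    apply: (is_D_C0_on (f' := fun z => a z * W n z)) => z Iz.
    by apply: YD0 => //; exact: C0_onM.
  apply: (is_D_C0_on (f' := fun z => b z * Y n z + F z)) => z Iz.
  by apply: YD0 => //; apply: C0_onD => //; exact: C0_onM.
have YD n z : I01 z -> is_D I01 (Y n.+1) z (a z * W n z).
  by move=> Iz; apply: YD0 => //; apply: C0_onM => //; apply: (YW_c n).2.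
have WD n z : I01 z -> is_D I01 (W n.+1) z (b z * Y n z + F z).
  move=> Iz; apply: YD0 => //; apply: C0_onD => //; apply: C0_onM => //.
  exact: (YW_c n).1.
have prim0 f : prim f 0 = 0 by rewrite /prim set_itv1 Rintegral_set1.
have Y0 n : Y n 0 = y0 by case: n => [//|n]; rewrite /Y /= prim0 addr0.
have W0 n : W n 0 = w0 by case: n => [//|n]; rewrite /W /= prim0 addr0.
have [La La0 hLa] := C0_on_bounded ac.
have [Lb Lb0 hLb] := C0_on_bounded bc.
pose L := La + Lb.
have L0 : 0 < L by rewrite addr_gt0.
have aL z : I01 z -> `|a z| <= L by rewrite I01E => /hLa; rewrite /L; lra.
have bL z : I01 z -> `|b z| <= L by rewrite I01E => /hLb; rewrite /L; lra.
have [K1 K10 hK1] := C0_on_bounded (C0_onB (YW_c 1%N).1 (YW_c 0%N).1).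
have [K2 K20 hK2] := C0_on_bounded (C0_onB (YW_c 1%N).2 (YW_c 0%N).2).
pose K := K1 + K2.
have K0 : 0 < K by rewrite addr_gt0.
(* g n bounds the n-th increment; g n.+1 is chosen to have derivative L * g n. *)
pose g n z := K * (1 / 2) ^+ n * expR (2 * L * z).
have gD n z : is_D I01 (g n.+1) z (L * g n z).
  have -> : L * g n z = K * (1 / 2) ^+ n.+1 * (2 * L * expR (2 * L * z)).
    by rewrite /g exprS; field.
  by apply: is_DZ; exact: is_D_expR.
have bound n z : I01 z -> `|Y n.+1 z - Y n z| <= g n z /\ `|W n.+1 z - W n z| <= g n z.
  elim: n z => [|n IH] z Iz.
    have e1 : 1 <= expR (2 * L * z).
      rewrite -expR0 ler_expR; move: Iz; rewrite I01E => /andP[z0 _].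
      by rewrite mulr_ge0// mulr_ge0// ltW.
    have : K <= g 0%N z by rewrite /g expr0 mulr1 ler_peMr// ltW.
    move: Iz; rewrite I01E => /[dup] /hK1 + /hK2; rewrite /K; lra.
  have g0 m : 0 <= g m 0 by rewrite /g !mulr_ge0 ?expR_ge0 ?exprn_ge0 ?divr_ge0 ?ltW.
  have next d d' : (forall x, I01 x -> is_D I01 d x (d' x)) ->
      (forall x, I01 x -> `|d' x| <= L * g n x) -> d 0 = 0 ->
      `|d z| <= g n.+1 z.
    move=> dD dL d0; apply: (is_D_compare dD (fun x _ => gD n x) dL) => //.
    by rewrite d0 normr0.
  split.
    apply: next (fun x Ix => is_DB (YD n.+1 x Ix) (YD n x Ix)) _ _; last first.
      by rewrite !Y0 subrr.
    by move=> x Ix; rewrite -mulrBr normrM ler_pM ?aL//; exact: (IH x Ix).2.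
  apply: next (fun x Ix => is_DB (WD n.+1 x Ix) (WD n x Ix)) _ _; last first.
    by rewrite !W0 subrr.
  move=> x Ix; rewrite opprD addrACA subrr addr0 -mulrBr normrM ler_pM ?bL//.
  exact: (IH x Ix).1.
pose M : R^nat := geometric (K * expR (2 * L)) (1 / 2).
have Mc : cvgn (series M) by apply: is_cvg_geometric_series; rewrite ger0_norm; lra.
have gM n z : I01 z -> g n z <= M n.
  rewrite I01E => /andP[_ z1]; rewrite /g /M /geometric /= mulrAC ler_pM2r ?exprn_gt0 ?divr_gt0//.
  by rewrite ler_pM2l// ler_expR -[leRHS]mulr1 ler_pM2l// mulr_gt0.
have [y [Ty [yc Ty0 hy]]] := uniform_limit (fun n => (YW_c n).1)
  (fun n z Iz => le_trans (bound n z Iz).1 (gM n z Iz)) Mc.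
have [w [Tw [wc Tw0 hw]]] := uniform_limit (fun n => (YW_c n).2)
  (fun n z Iz => le_trans (bound n z Iz).2 (gM n z Iz)) Mc.
have lim_eq (c d : R) (T T' : R^nat) : T @ \oo --> 0 -> T' @ \oo --> 0 ->
    (forall n, `|c - d| <= L * T n + T' n.+1) -> c = d.
  move=> Tc T'c h; apply/eqP; rewrite -subr_eq0 -normr_le0.
  have c1 : (fun n => L * T n + T' n.+1) @ \oo --> 0.
    rewrite -[0]addr0 -[X in X + _](mulr0 L); apply: cvgD.
      by apply: cvgM => //; exact: cvg_cst.
    by rewrite cvg_shiftS.
  exact: (ler_cvg_to (cvg_cst _) c1 (nearW _ h)).
(* c is the defect of the limit in the integral equation and d n the defect of
   the n-th iterate, whose derivative is small with the error of the iterate. *)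
have limit_eq c d d' (S T : R^nat) : S @ \oo --> 0 -> T @ \oo --> 0 ->
    (forall n z, I01 z -> is_D I01 (d n) z (d' n z)) ->
    (forall n z, I01 z -> `|d' n z| <= L * S n) -> (forall n, d n 0 = 0) ->
    (forall n z, I01 z -> `|c z - d n z| <= T n.+1) ->
    forall z, I01 z -> c z = 0.
  move=> Sc Tc dD dL d0 cd z Iz; apply: (lim_eq _ _ S T) => // n; rewrite subr0.
  have S0 : 0 <= L * S n by exact: le_trans (dL n z Iz).
  have : `|d n z| <= L * S n * z.
    apply: (is_D_compare (g := fun x => L * S n * x) (g' := fun=> L * S n)
      (dD n) _ (dL n)) => // [x _|]; first exact: is_D_linear.
    by rewrite d0 mulr0 normr0.
  have : L * S n * z <= L * S n by rewrite ler_piMr//; move: Iz; rewrite I01E => /andP[].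
  rewrite -{1}(subrK (d n z) (c z)).
  have := ler_normD (c z - d n z) (d n z); have := cd n z Iz; lra.
have YE z : I01 z -> y0 + prim (fun s => a s * w s) z = y z.
  move=> Iz; apply/eqP; rewrite -subr_eq0; apply/eqP; move: z Iz.
  apply: (limit_eq (fun z => y0 + prim (fun s => a s * w s) z - y z)
    (fun n z => y0 + prim (fun s => a s * w s) z - Y n.+1 z)
    (fun n z => a z * w z - a z * W n z) Tw Ty) => //.
  - by move=> n z Iz; apply: is_DB; [apply: YD0 => //; exact: C0_onM|exact: YD].
  - by move=> n z Iz; rewrite -mulrBr normrM ler_pM ?aL// hw.
  - by move=> n; rewrite prim0 addr0 Y0 subrr.
  - by move=> n z Iz; rewrite opprB addrC addrA subrK -normrN opprB hy.
have WE z : I01 z -> w0 + prim (fun s => b s * y s + F s) z = w z.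
  move=> Iz; apply/eqP; rewrite -subr_eq0; apply/eqP; move: z Iz.
  apply: (limit_eq (fun z => w0 + prim (fun s => b s * y s + F s) z - w z)
    (fun n z => w0 + prim (fun s => b s * y s + F s) z - W n.+1 z)
    (fun n z => (b z * y z + F z) - (b z * Y n z + F z)) Ty Tw) => //.
  - move=> n z Iz; apply: is_DB; [apply: YD0 => //|exact: WD].
    by apply: C0_onD => //; exact: C0_onM.
  - move=> n z Iz; rewrite opprD addrACA subrr addr0 -mulrBr normrM ler_pM ?bL//.
    exact: hy.
  - by move=> n; rewrite prim0 addr0 W0 subrr.
  - by move=> n z Iz; rewrite opprB addrC addrA subrK -normrN opprB hw.
exists y, w; split.
- move=> z Iz; apply: (is_D_ext Iz YE); apply: YD0 => //; exact: C0_onM.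
- move=> z Iz; apply: (is_D_ext Iz WE); apply: YD0 => //.
  by apply: C0_onD => //; exact: C0_onM.
- by rewrite -YE ?prim0 ?addr0//; exact: I01_0.
- by rewrite -WE ?prim0 ?addr0//; exact: I01_0.
Qed.

End UniformLimits.

(** * Smooth cutoffs on the unit interval *)

Section SmoothFunctions.
Context {R : realType}.
Local Notation I01 := (@I01 R).
Implicit Types f g : R -> R.

Lemma C1_on_ext f g : (forall z, I01 z -> f z = g z) -> C1_on I01 f -> C1_on I01 g.
Proof.
move=> fg f1; have [_ _ fc] := f1; apply: is_D_C1_on fc => z Iz.
by apply: (is_D_ext Iz fg); exact: C1_on_is_D.
Qed.

Lemma C1_onD f g : C1_on I01 f -> C1_on I01 g -> C1_on I01 (fun z => f z + g z).
Proof.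
move=> f1 g1; have [_ _ fc] := f1; have [_ _ gc] := g1.
by apply: is_D_C1_on (C0_onD fc gc) => z Iz; apply: is_DD; exact: C1_on_is_D.
Qed.

Lemma C1_onM f g : C1_on I01 f -> C1_on I01 g -> C1_on I01 (fun z => f z * g z).
Proof.
move=> f1 g1; have [f0 _ fc] := f1; have [g0 _ gc] := g1.
apply: is_D_C1_on (C0_onD (C0_onM fc g0) (C0_onM f0 gc)) => z Iz.
by apply: is_DM; exact: C1_on_is_D.
Qed.

Lemma D01M f g z : C1_on I01 f -> C1_on I01 g -> I01 z ->
  D01 (fun z => f z * g z) z = D01 f z * g z + f z * D01 g z.
Proof. by move=> f1 g1 Iz; apply: is_D_D01 => //; apply: is_DM; exact: C1_on_is_D. Qed.

Lemma C2_onM f g : C2_on I01 f -> C2_on I01 g -> C2_on I01 (fun z => f z * g z).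
Proof.
move=> [f1 f2] [g1 g2]; split; first exact: C1_onM.
apply: C1_on_ext (fun z Iz => esym (D01M f1 g1 Iz)) _.
by apply: C1_onD; exact: C1_onM.
Qed.

Lemma C2_on_affine (a b : R) : C2_on I01 (fun z => a + b * z).
Proof.
have fD (z : R) : is_D I01 (fun z => a + b * z) z b.
  by rewrite -{2}[b]add0r; apply: is_DD; [exact: is_D_cst|exact: is_D_linear].
split.
  by apply: (is_D_C1_on (f' := fun=> b)); [move=> z _; exact: fD|exact: C0_on_cst].
apply: (C1_on_ext (f := fun=> b)).
  by move=> z Iz; rewrite [RHS](is_D_D01 Iz (fD z)).
apply: (is_D_C1_on (f' := fun=> 0)); last exact: C0_on_cst.
by move=> z _; exact: is_D_cst.
Qed.

Lemma C2_onX f n : C2_on I01 f -> C2_on I01 (fun z => f z ^+ n).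
Proof.
move=> f2; elim: n => [|n IH].
  rewrite (_ : (fun z => _) = (fun z => 1 + 0 * z)); first exact: C2_on_affine.
  by apply/funext => z; rewrite mul0r addr0.
by under eq_fun do rewrite exprS; exact: C2_onM.
Qed.

Lemma C2_onD f g : C2_on I01 f -> C2_on I01 g -> C2_on I01 (fun z => f z + g z).
Proof.
move=> [f1 f2] [g1 g2]; split; first exact: C1_onD.
apply: (C1_on_ext (f := fun z => D01 f z + D01 g z)); last exact: C1_onD.
by move=> z Iz; rewrite [RHS](is_D_D01 Iz (is_DD (C1_on_is_D f1 Iz) (C1_on_is_D g1 Iz))).
Qed.

Lemma is_DX I f z d n : is_D I f z d ->
  is_D I (fun y => f y ^+ n.+1) z (n.+1%:R * f z ^+ n * d).
Proof.
move=> fd; elim: n => [|n IH].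
  by rewrite expr0 !mul1r; under eq_fun do rewrite expr1.
under eq_fun do rewrite exprS.
rewrite (_ : _ * d = d * f z ^+ n.+1 + f z * (n.+1%:R * f z ^+ n * d)).
  exact: (is_DM fd IH).
by rewrite -[n.+2]add1n natrD exprS; ring.
Qed.

(** The bump equals 1 at both endpoints and tends to 0 in mean as k grows, so the
  cutoff vanishes to second order at both endpoints and tends to 1 in mean. *)
Definition bump k (z : R) := (1 - 2 * z) ^+ (2 * k).
Definition cutoff k (z : R) := (1 - bump k z) ^+ 2.

Lemma bump_ge0 k z : 0 <= bump k z.
Proof. by rewrite /bump exprM exprn_ge0// sqr_ge0. Qed.

Lemma bump_le1 k z : I01 z -> bump k z <= 1.
Proof.
rewrite I01E => z01; rewrite /bump exprM exprn_ile1 ?sqr_ge0//; nra.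
Qed.

Lemma bump_C2 k : C2_on I01 (bump k).
Proof.
apply: C2_onX; rewrite (_ : (fun z => _) = (fun z => 1 + - 2 * z)).
  exact: C2_on_affine.
by apply/funext => z; rewrite mulNr.
Qed.

Lemma J_bump k : J (bump k) = (2 * k).+1%:R^-1.
Proof.
have n0 : ((2 * k).+1%:R : R) != 0 by rewrite pnatr_eq0.
rewrite (J_FTC (f := fun z => - (2 * (2 * k).+1%:R)^-1 * (1 - 2 * z) ^+ (2 * k).+1)).
- rewrite !mulr0 mulr1 subr0 expr1n (_ : 1 - 2 = - 1); last by ring.
  rewrite (_ : (- 1) ^+ (2 * k).+1 = - 1).
    by move: n0; set c := _%:R => n0; field.
  by rewrite -signr_odd mul2n /= odd_double.
- move=> z _.
  have -> : bump k z = - (2 * (2 * k).+1%:R)^-1 *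
      ((2 * k).+1%:R * (1 - 2 * z) ^+ (2 * k) * (0 - 2)).
    by move: n0; rewrite /bump; set c := _.+1%:R => n0; field.
  apply: is_DZ; apply: is_DX; apply: is_DB; first exact: is_D_cst.
  exact: is_D_linear.
by case: (bump_C2 k) => [[]].
Qed.

Lemma cutoff_C2 k : C2_on I01 (cutoff k).
Proof.
apply: C2_onX.
rewrite (_ : (fun z => _) = (fun z => (1 + 0 * z) + (-1 + 0 * z) * bump k z)).
  apply: C2_onD; first exact: C2_on_affine.
  by apply: C2_onM; [exact: C2_on_affine|exact: bump_C2].
by apply/funext => z; ring.
Qed.

Lemma bump_endpoint k : bump k 0 = 1 /\ bump k 1 = 1.
Proof.
rewrite /bump mulr0 subr0 expr1n mulr1 (_ : 1 - 2 = - 1); last by ring.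
by rewrite -signr_odd mul2n odd_double.
Qed.

Lemma cutoff_endpoint k z : I01 z -> bump k z = 1 -> cutoff k z = 0 /\ D01 (cutoff k) z = 0.
Proof.
move=> Iz bz; split; first by rewrite /cutoff bz subrr expr0n.
apply: is_D_D01 => //; rewrite /cutoff.
have [b1 _] := bump_C2 k.
rewrite (_ : 0 = 2 * (1 - bump k z) ^+ 1 * (0 - D01 (bump k) z)); last first.
  by rewrite bz subrr expr1 mulr0 mul0r.
apply: is_DX; apply: is_DB; [exact: is_D_cst|exact: C1_on_is_D].
Qed.

Lemma cutoff_mul_endpoint k f z : C2_on I01 f -> I01 z -> bump k z = 1 ->
  f z * cutoff k z = 0 /\ D01 (fun z => f z * cutoff k z) z = 0.
Proof.
move=> [f1 _] Iz bz; have [c0 c1] := cutoff_endpoint Iz bz.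
have [cc _] := cutoff_C2 k.
by rewrite D01M// c0 c1 !mulr0 addr0.
Qed.

End SmoothFunctions.

(** * Functions of time and space *)

Section TimeDependence.
Context {R : realType}.
Local Notation I01 := (@I01 R).
Local Notation mu := (@lebesgue_measure R).
Local Notation Rplus := (@Rplus R).
Local Notation Rpos := (@Rpos R).

(** Primitives of f and g have the same derivative at interior points.  This
  carries the partial differential equation, which is only required inside the
  interval, over to integrals. *)
Lemma J_eq_oo (f g : R -> R) : C0_on I01 f -> C0_on I01 g ->
  (forall z, 0 < z < 1 -> f z = g z) -> J f = J g.
Proof.
move=> fc gc fg.
have le h k : C0_on I01 h -> C0_on I01 k -> (forall z, 0 < z < 1 -> h z = k z) -> J h <= J k.
  move=> hc kc hk.
  pose P h' x := (\int[mu]_(s in `[0%R, x]) h' s)%R.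
  have PD z : I01 z -> is_D I01 (fun x => P h x - P k x) z (h z - k z).
    by move=> Iz; apply: is_DB; exact: is_D_primitive.
  rewrite -subr_le0.
  have -> : 0 = P h 0 - P k 0 :> R by rewrite /P set_itv1 !Rintegral_set1 subrr.
  apply: (is_D_le0_nincr (I := I01) (f := fun x => P h x - P k x)
    (f' := fun z => h z - k z)) => //.
  - by move=> z z01; apply: is_D_cvg (PD z _); rewrite I01E.
  - move=> z z01; have Iz : I01 z by rewrite I01E; lra.
    by apply: is_D_sub (PD z Iz); exact: subset_itv_oo_cc.
  - by move=> z z01; rewrite hk// subrr.
apply/eqP; rewrite eq_le !le// => z z01; exact/esym/fg.
Qed.

Lemma RplusE (t : R) : Rplus t = (0 <= t) :> Prop.
Proof. by rewrite /Defs.Rplus /= in_itv /= andbT. Qed.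

Lemma RposE (t : R) : Rpos t = (0 < t) :> Prop.
Proof. by rewrite /Defs.Rpos /= in_itv /= andbT. Qed.

(** A tube lemma: by compactness of the unit interval, continuity in the first
  variable is uniform in the second one. *)
Lemma C0_on2_uniform I (f : R -> R -> R) s0 e : C0_on2 I I01 f -> I s0 -> 0 < e ->
  exists2 del, 0 < del & forall s, I s -> `|s - s0| < del ->
    forall z, I01 z -> `|f s z - f s0 z| <= e.
Proof.
move=> fc Is0 e0.
have /compact_near_coveringP cov := @segment_compact R 0 1.
have e2 : 0 < e / 2 by rewrite divr_gt0.
have H z : I01 z -> \forall z' \near z & s \near within I (nbhs s0),
    I01 z' -> `|f s z' - f s0 z'| <= e.
  move=> Iz.
  have /subspace_continuousP fc' := fc.
  have := fc' (s0, z) (conj Is0 Iz).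
  move=> /cvgrPdist_le /(_ _ e2) [[B A] /= [B0 A0] BA].
  exists (A, [set s | I s /\ B s]).
    by split => //=; move: B0; rewrite /within /=; apply: filterS => s Bs Is.
  move=> [z' s] /= [Az' [Is Bs]] Iz'.
  have Bs0 : B s0 by exact: nbhs_singleton.
  have h1 := BA (s, z') (conj Bs Az') (conj Is Iz').
  have h2 := BA (s0, z') (conj Bs0 Az') (conj Is0 Iz').
  rewrite /= in h1 h2.
  rewrite (_ : f s z' - f s0 z' = (f s0 z - f s0 z') - (f s0 z - f s z')); last by ring.
  rewrite (le_trans (ler_normB _ _))//; lra.
have /nbhs_ballP[del /= del0 hd] : nbhs s0 [set s | I s ->
    I01 `<=` [set z | I01 z -> `|f s z - f s0 z| <= e]].
  exact: (cov _ (within I (nbhs s0)) _ _ H).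
exists del => // s Is ss0 z Iz.
by apply: (hd s _ Is z Iz Iz) => //; rewrite /ball/= distrC.
Qed.

Lemma C0_on2_slice I J (f : R -> R -> R) t : C0_on2 I J f -> I t -> C0_on J (f t).
Proof.
move=> fc It; apply/C0_onP => z Jz.
have /subspace_continuousP fc' := fc.
have := fc' (t, z) (conj It Jz).
move=> /cvgrPdist_le h; apply/cvgrPdist_le => e e0.
have [[B A] /= [B0 A0] BA] := h e e0.
rewrite /prop_near1 /within /=; apply: filterS A0 => z' Az' Jz'.
by apply: (BA (t, z')) => //; split => //; exact: nbhs_singleton.
Qed.

Lemma C0_on2_bounded (f : R -> R -> R) t : C0_on2 Rplus I01 f ->
  exists M, forall s z, 0 <= s <= t -> I01 z -> `|f s z| <= M.
Proof.
move=> fc.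
have fc' : {within `[0, t] `*` I01, continuous (fun tz : R * R => f tz.1 tz.2)}.
  apply: continuous_subspaceW fc => -[s z] [/= s0 Iz]; split => //=.
  by move: s0; rewrite RplusE in_itv /= => /andP[].
have cpt := compact_setX (@segment_compact R 0 t) (@segment_compact R 0 1).
have /compact_bounded[M [_ hM]] := continuous_compact fc' cpt.
exists (`|M| + 1) => s z st Iz; apply: hM.
  by rewrite (le_lt_trans (ler_norm M))// ltrDl.
by exists (s, z) => //; split => //=; rewrite in_itv.
Qed.

(** With the integrating factor exp(l s), both f - M / l and - f - M / l become
  nonincreasing. *)
Lemma scalar_decay (f h : R -> R) l M t : 0 < l -> 0 <= t -> C0_on Rplus f ->
  (forall s, 0 < s < t -> is_D Rpos f s (- l * f s + h s)) ->
  (forall s, 0 < s < t -> `|h s| <= M) ->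
  `|f t| <= expR (- l * t) * `|f 0| + (1 - expR (- l * t)) * (M / l).
Proof.
move=> l0 t0 fc fd hM.
have l1 : l != 0 by rewrite gt_eqF.
have one (k : R) : k ^+ 2 = 1 ->
    k * f t <= expR (- l * t) * (k * f 0) + (1 - expR (- l * t)) * (M / l).
  move=> k2.
  pose H s := expR (l * s) * (k * f s - M / l).
  have : H t <= H 0.
    apply: (is_D_le0_nincr (I := Rplus)
      (f' := fun s => l * expR (l * s) * (k * f s - M / l) +
        expR (l * s) * (k * (- l * f s + h s) - 0)) t0).
    - by move=> s /=; rewrite RplusE in_itv /= => /andP[].
    - move=> s /andP[s0 _].
      have Hc : C0_on Rplus H.
        apply: C0_onM.
          apply: (is_D_C0_on (f' := fun s => l * expR (l * s))) => z _.
          exact: is_D_expR.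
        apply: C0_onB; last exact: C0_on_cst.
        by apply: C0_onM => //; exact: C0_on_cst.
      by move/C0_onP : Hc; apply; rewrite RplusE.
    - move=> s st; apply: (@is_D_sub _ Rpos).
        by move=> y /=; rewrite RposE in_itv /= => /andP[].
      apply: is_DM; first exact: is_D_expR.
      by apply: is_DB; [apply: is_DZ; exact: fd|exact: is_D_cst].
    - move=> s st /=.
      rewrite [leLHS](_ : _ = expR (l * s) * (k * h s - M)); last by field.
      rewrite pmulr_rle0 ?expR_gt0// subr_le0 (le_trans _ (hM s st))//.
      rewrite (le_trans (ler_norm _))// normrM.
      have -> : `|k| = 1; last by rewrite mul1r.
      by apply/eqP; rewrite -(@pexpr_eq1 _ _ 2)// -normrX k2 normr1.
  rewrite /H mulr0 expR0 mul1r => hH.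
  have e1 : expR (- l * t) * expR (l * t) = 1 by rewrite -expRD mulNr addNr expR0.
  have : expR (- l * t) * (expR (l * t) * (k * f t - M / l)) <= expR (- l * t) * (k * f 0 - M / l).
    by rewrite ler_pM2l ?expR_gt0.
  rewrite mulrA e1 mul1r; lra.
have e0 := expR_gt0 (- l * t).
have N1 : (- 1) ^+ 2 = 1 :> R by rewrite sqrrN expr1n.
have := one 1 (expr1n _ _); have := one (- 1) N1.
have := ler_norm (f 0); have := ler_norm (- f 0); rewrite normrN => h1 h2 h3 h4.
have : expR (- l * t) * f 0 <= expR (- l * t) * `|f 0| by rewrite ler_pM2l.
have : expR (- l * t) * - f 0 <= expR (- l * t) * `|f 0| by rewrite ler_pM2l.
rewrite ler_norml => *; apply/andP; split; lra.
Qed.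

(** Applied with the same e for all z, this makes the difference quotients in
  time converge uniformly in z, so that they can be integrated. *)
Lemma mean_value_le (f f' : R -> R) (d e t s : R) : 0 < t -> 0 < s ->
  (forall y, 0 < y -> is_D Rpos f y (f' y)) ->
  (forall y, `|y - t| <= `|s - t| -> 0 < y -> `|f' y - d| <= e) ->
  `|f s - f t - d * (s - t)| <= e * `|s - t|.
Proof.
move=> t0 s0 fd fe.
have main (k a b : R) : `|k| = 1 -> a <= b -> 0 < a -> 
    (forall y, a <= y <= b -> `|f' y - d| <= e) ->
    k * (f b - f a - d * (b - a)) <= e * (b - a).
  move=> k1 ab a0 he.
  suff : k * f b - (k * d + e) * b <= k * f a - (k * d + e) * a by lra.
  apply: (is_D_le0_nincr (I := Rpos) (f := fun x => k * f x - (k * d + e) * x)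
    (f' := fun x => k * f' x - (k * d + e)) ab).
  - move=> y /=; rewrite RposE in_itv /= => /andP[ay _]; exact: lt_le_trans ay.
  - move=> z /andP[az _]; apply: is_D_cvg.
    apply: is_DB; last exact: is_D_linear.
    by apply: is_DZ; apply: fd; exact: lt_le_trans az.
  - move=> z /andP[az zb]; apply: (@is_D_sub _ Rpos).
      by move=> y /=; rewrite RposE in_itv /= => /andP[ay _]; exact: lt_trans ay.
    apply: is_DB; last exact: is_D_linear.
    by apply: is_DZ; apply: fd; exact: lt_trans az.
  - move=> z zab; have : `|f' z - d| <= e by apply: he; lra.
    have : k * (f' z - d) <= `|f' z - d|.
      by rewrite (le_trans (ler_norm _))// normrM k1 mul1r.
    lra.
have [ts|st] := leP t s.
  rewrite ger0_norm in fe *; last by lra.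
  have he y : t <= y <= s -> `|f' y - d| <= e.
    by move=> ?; apply: fe; [rewrite ger0_norm; lra|lra].
  have := main 1 t s (normr1 _) ts t0 he.
  have := main (-1) t s (normrN1 _) ts t0 he.
  rewrite ler_norml => *; apply/andP; split; lra.
rewrite ltr0_norm in fe *; last by lra.
have he y : s <= y <= t -> `|f' y - d| <= e.
  by move=> ?; apply: fe; [rewrite ler0_norm; lra|lra].
have := main 1 s t (normr1 _) (ltW st) s0 he.
have := main (-1) s t (normrN1 _) (ltW st) s0 he.
rewrite ler_norml => *; apply/andP; split; lra.
Qed.

(** For s = e the difference is e / (2 - e) ((1 - e) a - (2 - e) b)^2, the weight
  being the one for which b^2 has coefficient 1; and s / (2 - s) increases
  with s. *)
Lemma decay_square (e a b s : R) : 0 < e -> e <= s -> s <= 1 ->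
  (e * a + (1 - e) * b) ^+ 2 <= s / (2 - s) * a ^+ 2 + b ^+ 2.
Proof.
move=> e0 es s1.
have e2 : 0 < 2 - e by lra.
have s2 : 0 < 2 - s by lra.
apply: (@le_trans _ _ (e / (2 - e) * a ^+ 2 + b ^+ 2)).
  rewrite -subr_ge0.
  rewrite (_ : _ - _ = e / (2 - e) * ((1 - e) * a - (2 - e) * b) ^+ 2).
    by rewrite mulr_ge0 ?sqr_ge0// divr_ge0 ?ltW.
  by field; rewrite gt_eqF.
rewrite lerD2r ler_wpM2r ?sqr_ge0// ler_pdivrMr// mulrAC ler_pdivlMr//; nra.
Qed.

Lemma young_square (a b k : R) : 0 < k ->
  (a + b) ^+ 2 <= (1 + k) * a ^+ 2 + (1 + k^-1) * b ^+ 2.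
Proof.
move=> k0; rewrite -subr_ge0.
rewrite (_ : _ - _ = k^-1 * (k * a - b) ^+ 2).
  by rewrite mulr_ge0 ?sqr_ge0// invr_ge0 ltW.
by field; rewrite gt_eqF.
Qed.

End TimeDependence.

(** * The Sturm-Liouville equation *)

Section SturmLiouvilleEquation.
Context {R : realType}.
Local Notation I01 := (@I01 R).
Local Notation mu := (@lebesgue_measure R).

(** The integral of |f - g| vanishes.  Eigenfunctions satisfy their equation
  almost everywhere, and this upgrades it to every point. *)
Lemma ae_eq_continuous (f g : R -> R) : C0_on I01 f -> C0_on I01 g ->
  {ae mu, forall z, I01 z -> f z = g z} -> forall z, I01 z -> f z = g z.
Proof.
move=> fc gc fg z Iz; apply/eqP; rewrite -subr_eq0 -normr_eq0; apply/eqP; move: z Iz.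
have hc := C0_on_normr (C0_onB fc gc).
apply: (J_eq0 hc); first by move=> z _; exact: normr_ge0.
rewrite /J /Rintegral (ae_eq_integral (cst 0%E)) ?integral0//.
- exact: measurable_I01.
- by have /integrableP[] := integrable_I01 hc.
- move: fg; apply: (@filterS _ (almost_everywhere mu)) => z fgz Iz.
  by rewrite /= fgz// subrr normr0.
Qed.

Lemma C2_H2 (f : R -> R) : C2_on I01 f -> H2 f.
Proof.
move=> [f1 f2]; split => //; exists (D01 (D01 f)).
have c2 : C0_on I01 (D01 (D01 f)) by case: f2.
split.
- have /integrableP[+ _] := integrable_I01 c2.
  by move/measurable_EFinP.
- apply: (@integrable_I01 _ (fun z => `|D01 (D01 f) z| ^+ 2)); apply: C0_onX; exact: C0_on_normr.
move=> z Iz.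
apply: (is_D_unique01 (f := D01 f) (f' := D01 (D01 f))
  (g := fun z => D01 f 0 + (\int[mu]_(s in `[0%R, z]) D01 (D01 f) s)%R) _ _ _ Iz).
- by rewrite set_itv1 Rintegral_set1 addr0.
- by move=> x Ix; exact: C1_on_is_D.
- move=> x Ix; rewrite -[D01 (D01 f) x]add0r; apply: is_DD; first exact: is_D_cst.
  exact: is_D_primitive.
Qed.

Context (p r q : R -> R).
Hypotheses (p_C1 : C1_on I01 p) (p_gt0 : forall z, I01 z -> 0 < p z)
  (r_C0 : C0_on I01 r) (r_gt0 : forall z, I01 z -> 0 < r z)
  (q_C0 : C0_on I01 q).

(** The equation (p y')' = (q - l r) y + F as a first order system for y and
  its flux w = p y'. *)
Definition SLsol (l : R) (F y w : R -> R) : Prop := forall z, I01 z ->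
  is_D I01 y z (w z / p z) /\ is_D I01 w z ((q z - l * r z) * y z + F z).

Lemma p_C0 : C0_on I01 p. Proof. by case: p_C1. Qed.

Lemma p_neq0 z : I01 z -> p z != 0. Proof. by move=> /p_gt0/lt0r_neq0. Qed.

Lemma pV_C0 : C0_on I01 (fun z => (p z)^-1).
Proof. by apply: C0_onV; [exact: p_neq0|exact: p_C0]. Qed.

Lemma coef_C0 l : C0_on I01 (fun z => q z - l * r z).
Proof. by apply: C0_onB => //; apply: C0_onM => //; exact: C0_on_cst. Qed.

Lemma SLsol_C0 l F y w : SLsol l F y w -> C0_on I01 y /\ C0_on I01 w.
Proof.
move=> h; split.
  by apply: (is_D_C0_on (f' := fun z => w z / p z)) => z /h[].
by apply: (is_D_C0_on (f' := fun z => (q z - l * r z) * y z + F z)) => z /h[].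
Qed.

Lemma SLsol_exists l F y0 w0 : C0_on I01 F ->
  exists y w, [/\ SLsol l F y w, y 0 = y0 & w 0 = w0].
Proof.
move=> Fc.
have [y [w [yD wD <- <-]]] := linear_system_solution y0 w0 pV_C0 (@coef_C0 l) Fc.
by exists y, w; split => // z Iz; split; [rewrite mulrC; exact: yD|exact: wD].
Qed.

Lemma SLsol_D01 l F y w z : SLsol l F y w -> I01 z -> D01 y z = w z / p z.
Proof. by move=> h Iz; apply: is_D_D01 => //; exact: (h z Iz).1. Qed.

Lemma SLsol_flux l F y w z : SLsol l F y w -> I01 z ->
  is_D I01 (fun z => p z * D01 y z) z ((q z - l * r z) * y z + F z).
Proof.
move=> h Iz; apply: (is_D_ext (f := w) Iz); last exact: (h z Iz).2.
by move=> x Ix; rewrite (SLsol_D01 h Ix) mulrC divfK// p_neq0.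
Qed.

Lemma SLsol_C2 l F y w : C0_on I01 F -> SLsol l F y w -> C2_on I01 y.
Proof.
move=> Fc h; have [yc wc] := SLsol_C0 h.
pose y' z := w z / p z.
pose y'' z := ((q z - l * r z) * y z + F z) / p z + w z * (- D01 p z / p z ^+ 2).
have y'D z : I01 z -> is_D I01 y' z (y'' z).
  move=> Iz; apply: is_DM; first exact: (h z Iz).2.
  by apply: is_DV; [exact: p_neq0|exact: C1_on_is_D].
have pc := pV_C0.
have y'c : C0_on I01 y' by exact: C0_onM.
have y''c : C0_on I01 y''.
  apply: C0_onD.
    by apply: C0_onM => //; apply: C0_onD => //; apply: C0_onM => //; exact: coef_C0.
  apply: C0_onM => //; apply: C0_onM; first by apply: C0_onN; case: p_C1.
  apply: C0_onV; first by move=> z Iz; rewrite expf_neq0// p_neq0.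
  by apply: C0_onX; exact: p_C0.
split; first by apply: (is_D_C1_on (f' := y')) => // z /h[].
apply: (is_D_C1_on (f' := y'')) => // z Iz.
by apply: (is_D_ext (f := y') Iz) (y'D z Iz) => x Ix; rewrite [RHS](SLsol_D01 h Ix).
Qed.

Lemma C2_flux y z : C2_on I01 y -> I01 z ->
  is_D I01 (fun z => p z * D01 y z) z (D01 p z * D01 y z + p z * D01 (D01 y) z).
Proof. by move=> [_ y2] Iz; apply: is_DM; exact: C1_on_is_D. Qed.

Lemma C2_flux_D01 y z : C2_on I01 y -> I01 z ->
  D01 (fun z => p z * D01 y z) z = D01 p z * D01 y z + p z * D01 (D01 y) z.
Proof. by move=> y2 Iz; apply: is_D_D01 => //; exact: C2_flux. Qed.

Lemma C2_flux_C0 y : C2_on I01 y -> C0_on I01 (D01 (fun z => p z * D01 y z)).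
Proof.
move=> y2; apply: C0_on_ext (fun z Iz => esym (C2_flux_D01 y2 Iz)) _.
case: y2 => [[_ _ yc] [_ _ y'c]].
by apply: C0_onD; apply: C0_onM => //; [case: p_C1|exact: p_C0].
Qed.

(** With F read off from the hypothesis, this applies to any C^2 function, such
  as a profile of the evolution. *)
Lemma C2_SLsol l F y : C2_on I01 y ->
  (forall z, I01 z -> D01 (fun z => p z * D01 y z) z = (q z - l * r z) * y z + F z) ->
  SLsol l F y (fun z => p z * D01 y z).
Proof.
move=> y2 hF z Iz; split.
  by rewrite mulrC mulrA mulVf ?p_neq0// mul1r; apply: C1_on_is_D => //; case: y2.
by rewrite -hF// C2_flux_D01//; exact: C2_flux.
Qed.

Lemma SLsol_comb l F G y w v x c : SLsol l F y w -> SLsol l G v x ->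
  SLsol l (fun z => F z + c * G z) (fun z => y z + c * v z) (fun z => w z + c * x z).
Proof.
move=> h k z Iz; have [h1 h2] := h z Iz; have [k1 k2] := k z Iz.
split.
  by rewrite mulrDl -mulrA; apply: is_DD => //; exact: is_DZ.
rewrite (_ : _ * _ + _ = ((q z - l * r z) * y z + F z) + c * ((q z - l * r z) * v z + G z)).
  by apply: is_DD => //; exact: is_DZ.
by ring.
Qed.

(** The inner product of L^2_r. *)
Definition ip (f g : R -> R) : R := J (fun z => r z * (f z * g z)).

Lemma ip_C0 f g : C0_on I01 f -> C0_on I01 g -> C0_on I01 (fun z => r z * (f z * g z)).
Proof. by move=> fc gc; apply: C0_onM => //; exact: C0_onM. Qed.

Lemma ipC f g : ip f g = ip g f.
Proof. by apply: eq_J => z _; rewrite (mulrC (f z)). Qed.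

Lemma eq_ip f f' g g' : (forall z, I01 z -> f z = f' z) ->
  (forall z, I01 z -> g z = g' z) -> ip f g = ip f' g'.
Proof. by move=> ff gg; apply: eq_J => z Iz; rewrite ff// gg. Qed.

Lemma ip_comb a b f f' g : C0_on I01 f -> C0_on I01 f' -> C0_on I01 g ->
  ip (fun z => a * f z + b * f' z) g = a * ip f g + b * ip f' g.
Proof.
move=> fc fc' gc; rewrite /ip -!J_Z -?J_D; do ?exact: ip_C0.
- by apply: eq_J => z _; ring.
- by apply: C0_onM; [exact: C0_on_cst|exact: ip_C0].
- by apply: C0_onM; [exact: C0_on_cst|exact: ip_C0].
Qed.

Lemma ipD f f' g : C0_on I01 f -> C0_on I01 f' -> C0_on I01 g ->
  ip (fun z => f z + f' z) g = ip f g + ip f' g.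
Proof.
move=> fc fc' gc; rewrite -[ip f g]mul1r -[ip f' g]mul1r -ip_comb//.
by apply: eq_ip => // z _; rewrite !mul1r.
Qed.

Lemma ipB f f' g : C0_on I01 f -> C0_on I01 f' -> C0_on I01 g ->
  ip (fun z => f z - f' z) g = ip f g - ip f' g.
Proof.
move=> fc fc' gc; rewrite -[ip f g]mul1r -[- ip f' g]mulN1r -ip_comb//.
by apply: eq_ip => // z _; rewrite !mul1r mulN1r.
Qed.

Lemma ipZ a f g : C0_on I01 f -> C0_on I01 g ->
  ip (fun z => a * f z) g = a * ip f g.
Proof.
move=> fc gc; rewrite -[RHS]addr0 -[X in _ + X](mul0r (ip f g)) -ip_comb//.
by apply: eq_ip => // z _; rewrite mul0r addr0.
Qed.

Lemma ip_ge0 f : 0 <= ip f f.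
Proof. by apply: J_ge0 => z Iz; rewrite mulr_ge0 ?(ltW (r_gt0 Iz))// -expr2 sqr_ge0. Qed.

Lemma ip_eq0 f : C0_on I01 f -> ip f f = 0 -> forall z, I01 z -> f z = 0.
Proof.
move=> fc /(J_eq0 (ip_C0 fc fc)) h z Iz.
have : r z * (f z * f z) = 0.
  by apply: h => // x Ix; rewrite mulr_ge0 ?(ltW (r_gt0 Ix))// -expr2 sqr_ge0.
by move/eqP; rewrite !mulf_eq0 orbb (gt_eqF (r_gt0 Iz)) /= => /eqP.
Qed.

Lemma norm2E f : norm2 r f = Num.sqrt (ip f f).
Proof.
by congr (Num.sqrt _); apply: eq_Rintegral => z _; rewrite real_normK ?num_real// expr2.
Qed.

Lemma norm2_sqr f : norm2 r f ^+ 2 = ip f f.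
Proof. by rewrite norm2E sqr_sqrtr// ip_ge0. Qed.

Lemma ip_sqr_le f c : C0_on I01 f -> (forall z, I01 z -> f z ^+ 2 <= c) ->
  ip f f <= c * J r.
Proof.
move=> fc h; rewrite -J_Z//; apply: le_J.
- exact: ip_C0.
- by apply: C0_onM => //; exact: C0_on_cst.
- by move=> z Iz; rewrite mulrC -expr2 ler_pM2r ?r_gt0// h.
Qed.

Lemma J_r_ge0 : 0 <= J r.
Proof. by apply: J_ge0 => z /r_gt0/ltW. Qed.

Lemma ip_young (f g : R -> R) : C0_on I01 f -> C0_on I01 g ->
  2 * ip f g <= ip f f + ip g g.
Proof.
move=> fc gc; rewrite -J_Z -?J_D; do ?exact: ip_C0.
apply: le_J.
- by apply: C0_onM; [exact: C0_on_cst|exact: ip_C0].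
- by apply: C0_onD; exact: ip_C0.
- move=> z Iz; rewrite -mulrDr mulrCA ler_pM2l ?r_gt0//.
  have := sqr_ge0 (f z - g z); nra.
Qed.

Lemma ip_cauchy_schwarz (f g : R -> R) : C0_on I01 f -> C0_on I01 g ->
  ip f g ^+ 2 <= ip f f * ip g g.
Proof.
move=> fc gc.
have h a b : 0 <= a ^+ 2 * ip f f + 2 * a * b * ip f g + b ^+ 2 * ip g g.
  have -> : a ^+ 2 * ip f f + 2 * a * b * ip f g + b ^+ 2 * ip g g =
      ip (fun z => a * f z + b * g z) (fun z => a * f z + b * g z).
    have afc : C0_on I01 (fun z => a * f z + b * g z).
      by apply: C0_onD; apply: C0_onM => //; exact: C0_on_cst.
    by rewrite ip_comb// !(ipC _ (fun z => _ + _)) !ip_comb// (ipC g f); ring.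
  exact: ip_ge0.
have [g0|g0] := eqVneq (ip g g) 0.
  have := h (- ip f g) (ip f f + 1); have := h (ip f g) (- 1).
  have := ip_ge0 f; rewrite g0; nra.
have gpos : 0 < ip g g by rewrite lt_def g0 ip_ge0.
have := h (ip g g) (- ip f g).
rewrite (_ : _ + _ = ip g g * (ip f f * ip g g - ip f g ^+ 2)); last by ring.
by rewrite pmulr_rge0// subr_ge0.
Qed.

(** Gronwall: the energy E = y^2 + w^2 satisfies E' <= L E + S r G^2, because all
  coefficients are bounded, and it starts from 0. *)
Lemma SLsol_gronwall l : exists2 K, 0 <= K & forall G y w, C0_on I01 G ->
  SLsol l (fun z => r z * G z) y w -> y 0 = 0 -> w 0 = 0 ->
  forall z, I01 z -> y z ^+ 2 <= K * ip G G /\ w z ^+ 2 <= K * ip G G.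
Proof.
have [P P0 hP] := C0_on_bounded pV_C0.
have [Q Q0 hQ] := C0_on_bounded (@coef_C0 l).
have [S S0 hS] := C0_on_bounded r_C0.
pose L := P + Q + 1.
(* P, Q and S bound 1 / p, q - l r and r; the last unit of L absorbs the
   square of w that comes from the source. *)
exists (expR L * S); first by rewrite mulr_ge0 ?expR_ge0// ltW.
move=> G y w Gc h y0 w0.
pose E z := y z ^+ 2 + w z ^+ 2.
pose f z := r z * (G z * G z).
have fc : C0_on I01 f by exact: ip_C0.
pose IF x := (\int[mu]_(s in `[0%R, x]) f s)%R.
pose E' z := 2 * y z * (w z / p z) + 2 * w z * ((q z - l * r z) * y z + r z * G z).
have ED z : I01 z -> is_D I01 E z (E' z).
  move=> Iz; have [h1 h2] := h z Iz.
  rewrite /E' (_ : _ + _ = (w z / p z * y z + y z * (w z / p z)) +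
     (((q z - l * r z) * y z + r z * G z) * w z +
      w z * ((q z - l * r z) * y z + r z * G z))); last by ring.
  have -> : E = (fun z => y z * y z + w z * w z) by apply/funext => x; rewrite /E !expr2.
  by apply: is_DD; apply: is_DM.
have E'le z : I01 z -> E' z <= L * E z + S * f z.
  move=> Iz; have := Iz; rewrite I01E => z01.
  have pz : 0 < (p z)^-1 by rewrite invr_gt0 p_gt0.
  have := hP z z01; rewrite ger0_norm ?(ltW pz)// => hPz.
  have := hQ z z01; rewrite ler_norml => /andP[q1 q2].
  have := hS z z01; rewrite ger0_norm ?(ltW (r_gt0 Iz))// => hSz.
  have e1 : 2 * y z * (w z / p z) <= P * E z.
    have -> : 2 * y z * (w z / p z) = (p z)^-1 * (2 * y z * w z) by ring.
    apply: (@le_trans _ _ ((p z)^-1 * E z)).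
      rewrite ler_pM2l// /E; have := sqr_ge0 (y z - w z); nra.
    by rewrite ler_wpM2r// addr_ge0// sqr_ge0.
  have e2 : 2 * w z * ((q z - l * r z) * y z) <= Q * E z.
    rewrite /E; set c := q z - l * r z in q1 q2 *.
    have : 0 <= (Q - c) * (y z + w z) ^+ 2 by rewrite mulr_ge0 ?sqr_ge0//; lra.
    have : 0 <= (Q + c) * (y z - w z) ^+ 2 by rewrite mulr_ge0 ?sqr_ge0//; lra.
    lra.
  have e3 : 2 * w z * (r z * G z) <= E z + S * f z.
    have : (r z * G z) ^+ 2 <= S * f z.
      rewrite /f -!expr2 exprMn expr2 -mulrA ler_wpM2r//.
      by rewrite mulr_ge0 ?sqr_ge0// ltW// r_gt0.
    rewrite /E; have := sqr_ge0 (w z - r z * G z); have := sqr_ge0 (y z); nra.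
  rewrite /E' mulrDr /L; lra.
pose H z := expR (- L * z) * E z - S * IF z.
pose H' z := (- L * expR (- L * z) * E z + expR (- L * z) * E' z) - S * f z.
have HD z : I01 z -> is_D I01 H z (H' z).
  move=> Iz; apply: is_DB.
    by apply: is_DM; [exact: is_D_expR|exact: ED].
  by apply: is_DZ; exact: is_D_primitive.
have f0 z : I01 z -> 0 <= f z.
  by move=> Iz; rewrite mulr_ge0 ?(ltW (r_gt0 Iz))// -expr2 sqr_ge0.
have H'le z : I01 z -> H' z <= 0.
  move=> Iz; rewrite /H'.
  have e1 : expR (- L * z) <= 1.
    rewrite -expR0 ler_expR mulNr oppr_le0 mulr_ge0//; first by rewrite /L; lra.
    by move: Iz; rewrite I01E => /andP[].
  have := expR_gt0 (- L * z); set e := expR _ in e1 * => e0.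
  have := E'le z Iz; have := f0 z Iz => fz0 hE.
  have : e * E' z <= e * (L * E z + S * f z) by rewrite ler_pM2l.
  have : e * (S * f z) <= S * f z by rewrite ler_piMl// mulr_ge0// ltW.
  lra.
move=> z Iz; have := Iz; rewrite I01E => /andP[z0 z1].
have := is_D_nincr01 (lexx 0) z0 z1 HD H'le.
rewrite /H /IF set_itv1 Rintegral_set1 /E y0 w0 expr0n /= !addr0 !mulr0 subr0 -/(IF z).
have IFle : IF z <= ip G G.
  have ND x : I01 x -> is_D I01 (fun x => - IF x) x (- f x).
    by move=> Ix; apply: is_DN; exact: is_D_primitive.
  have Nf x : I01 x -> - f x <= 0 by move=> Ix; rewrite oppr_le0 f0.
  by have := is_D_nincr01 z0 z1 (lexx 1) ND Nf; rewrite lerN2.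
rewrite subr_le0 => hE.
have : y z ^+ 2 + w z ^+ 2 <= expR L * S * ip G G.
  have -> : y z ^+ 2 + w z ^+ 2 = expR (L * z) * (expR (- L * z) * (y z ^+ 2 + w z ^+ 2)).
    by rewrite mulrA -expRD mulNr subrr expR0 mul1r.
  rewrite -mulrA; apply: ler_pM; rewrite ?expR_ge0//.
  - by rewrite mulr_ge0 ?expR_ge0// addr_ge0// sqr_ge0.
  - by rewrite ler_expR ler_piMr// /L; lra.
  - by rewrite (le_trans hE)// ler_pM2l.
have := sqr_ge0 (y z); have := sqr_ge0 (w z); split; lra.
Qed.

(** Green's identity: w v - y x is a primitive of the integrand, since the two
  products of fluxes in its derivative cancel. *)
Lemma SLsol_green l m F G y w v x :
  C0_on I01 F -> C0_on I01 G -> SLsol l F y w -> SLsol m G v x ->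
  J (fun z => (m - l) * (r z * (y z * v z)) + (F z * v z - y z * G z)) =
    (w 1 * v 1 - y 1 * x 1) - (w 0 * v 0 - y 0 * x 0).
Proof.
move=> Fc Gc h k; have [yc wc] := SLsol_C0 h; have [vc xc] := SLsol_C0 k.
apply: (J_FTC (f := fun z => w z * v z - y z * x z)).
  move=> z Iz; have [h1 h2] := h z Iz; have [k1 k2] := k z Iz.
  rewrite (_ : _ + _ = (((q z - l * r z) * y z + F z) * v z + w z * (x z / p z))
     - (w z / p z * x z + y z * ((q z - m * r z) * v z + G z))); last by ring.
  by apply: is_DB; exact: is_DM.
apply: C0_onD; first by apply: C0_onM; [exact: C0_on_cst|exact: ip_C0].
by apply: C0_onB; exact: C0_onM.
Qed.

(** * Boundary conditions, eigenfunctions and the resolvent *)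

Context (g0 v0 g1 v1 : R) (lam : nat -> R) (phi : nat -> R -> R).
Hypotheses (hyp_i : 0 < v0 \/ (v0 = 0 /\ g0 < 0))
  (hyp_ii : 0 < v1 \/ (v1 = 0 /\ 0 < g1))
  (lam_phi : SLspectrum p r q g0 v0 g1 v1 lam phi)
  (lam0_gt0 : 0 < lam 0%N).

Let N0 := g0 ^+ 2 + v0 ^+ 2.
Let N1 := g1 ^+ 2 + v1 ^+ 2.

Lemma N0_gt0 : 0 < N0.
Proof.
rewrite /N0; case: hyp_i => [v|[-> g]]; last by rewrite expr0n addr0 exprn_even_gt0//= lt_eqF.
by rewrite ltr_wpDl ?sqr_ge0// exprn_gt0.
Qed.

Lemma N1_gt0 : 0 < N1.
Proof.
rewrite /N1; case: hyp_ii => [v|[-> g]]; last by rewrite expr0n addr0 exprn_gt0.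
by rewrite ltr_wpDl ?sqr_ge0// exprn_gt0.
Qed.

Lemma lam_gt0 n : 0 < lam n.
Proof.
case: n => [//|n]; case: lam_phi => inc _ _.
by rewrite (lt_trans lam0_gt0)// inc.
Qed.

Lemma phi_C2 n : C2_on I01 (phi n).
Proof. by case: lam_phi => _ _ /(_ n)[]. Qed.

Lemma phi_C0 n : C0_on I01 (phi n).
Proof. by case: (phi_C2 n) => [[]]. Qed.

Lemma phi_bc n : bc0 g0 v0 (phi n) = 0 /\ bc1 g1 v1 (phi n) = 0.
Proof. by case: lam_phi => _ _ /(_ n)[[[]]]. Qed.

Lemma phi_norm n : ip (phi n) (phi n) = 1.
Proof. by case: lam_phi => _ _ /(_ n)[_ _ h]; rewrite -norm2_sqr h expr1n. Qed.

Lemma phi_sol n : SLsol (lam n) (fun=> 0) (phi n) (fun z => p z * D01 (phi n) z).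
Proof.
have c2 := phi_C2 n; apply: C2_SLsol => //.
apply: ae_eq_continuous.
- exact: C2_flux_C0.
- apply: C0_onD; last exact: C0_on_cst.
  by apply: C0_onM; [exact: coef_C0|exact: phi_C0].
- case: lam_phi => _ _ /(_ n)[[_ _ +] _ _].
  apply: (@filterS _ (almost_everywhere mu)) => z h Iz; have := h Iz.
  have rz := r_gt0 Iz; rewrite /SLop addr0; set X := D01 _ z => e.
  have -> : X = q z * phi n z - r z * (lam n * phi n z).
    by rewrite -e; field; rewrite gt_eqF.
  by ring.
Qed.

Lemma SLsol_eigenvalue l y w : SLsol l (fun=> 0) y w ->
  bc0 g0 v0 y = 0 -> bc1 g1 v1 y = 0 -> (exists2 z, I01 z & y z != 0) ->
  exists n, lam n = l.
Proof.
move=> h b0 b1 y0; case: lam_phi => _ /(_ l)[+ _] _; apply.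
exists y; split => //.
  split => //; apply: C2_H2; apply: SLsol_C2 h; exact: C0_on_cst.
apply/aeW => z Iz; rewrite /SLop (is_D_D01 Iz (SLsol_flux h Iz)).
by field; rewrite gt_eqF// r_gt0.
Qed.

(** The data annihilated by the boundary form are spanned by (v0, - g0), and
  (g0, v0) is orthogonal to them. *)
Lemma left_data (a y0 y1 : R) : g0 * y0 + v0 * y1 = a ->
  let c := (v0 * y0 - g0 * y1) / N0 in
  y0 = c * v0 + a * g0 / N0 /\ y1 = - c * g0 + a * v0 / N0.
Proof.
move=> <- c; have := lt0r_neq0 N0_gt0; rewrite /c /N0 => n0.
by split; field.
Qed.

(** The shooting solution: its initial data are (v0, - g0), scaled to the flux. *)
Lemma shooting_solution l : exists psi w, [/\ SLsol l (fun=> 0) psi w,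
  psi 0 = v0, w 0 = - (p 0 * g0) & bc0 g0 v0 psi = 0].
Proof.
have [y [w [h y0 w0]]] := SLsol_exists l v0 (- (p 0 * g0)) (C0_on_cst I01 0).
exists y, w; split => //; rewrite /bc0 (SLsol_D01 h I01_0) y0 w0.
by field; rewrite p_neq0//; exact: I01_0.
Qed.

(** The initial data allowed by the left boundary condition form the line spanned
  by those of the shooting solution. *)
Lemma SLsol_shift l F y w psi x : SLsol l F y w -> bc0 g0 v0 y = 0 ->
  SLsol l (fun=> 0) psi x -> psi 0 = v0 -> x 0 = - (p 0 * g0) ->
  exists c, [/\ SLsol l F (fun z => y z - c * psi z) (fun z => w z - c * x z),
    y 0 - c * psi 0 = 0 & w 0 - c * x 0 = 0].
Proof.
move=> h b k k0 x0.
have p0 : p 0 != 0 by apply: p_neq0; exact: I01_0.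
have [e0 e1] := left_data b; move: e0 e1; set c := _ / N0 => e0 e1.
exists c; split.
- have := SLsol_comb (- c) h k.
  have -> : (fun z => F z + - c * (fun=> 0) z) = F.
    by apply/funext => z; rewrite /= mulr0 addr0.
  have -> : (fun z => y z + - c * psi z) = (fun z => y z - c * psi z).
    by apply/funext => z; rewrite mulNr.
  have -> : (fun z => w z + - c * x z) = (fun z => w z - c * x z).
    by apply/funext => z; rewrite mulNr.
  by [].
- by rewrite k0 {1}e0 mul0r mul0r addr0 subrr.
- have : w 0 = p 0 * D01 y 0 by rewrite (SLsol_D01 h I01_0) mulrC divfK.
  by rewrite x0 => ->; rewrite e1 !mul0r; ring.
Qed.

Lemma gronwall0 l y w : SLsol l (fun=> 0) y w -> y 0 = 0 -> w 0 = 0 ->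
  forall z, I01 z -> y z = 0.
Proof.
move=> h y0 w0 z Iz; have [K K0 hK] := SLsol_gronwall l.
have h' : SLsol l (fun z => r z * (fun=> 0) z) y w.
  have -> : (fun z => r z * (fun=> 0) z) = (fun=> 0 : R).
    by apply/funext => x; rewrite /= mulr0.
  by [].
have [+ _] := hK _ _ _ (C0_on_cst I01 0) h' y0 w0 z Iz.
have -> : ip (fun=> 0) (fun=> 0) = 0.
  by rewrite -[RHS](J_cst 0); apply: eq_J => x _; rewrite /= !mulr0.
by rewrite mulr0 => y2; apply/eqP; rewrite -sqrf_eq0 eq_le y2 sqr_ge0.
Qed.

(** Otherwise 0 would be an eigenvalue, while all of them are positive. *)
Lemma SLsol_unique0 y w : SLsol 0 (fun=> 0) y w ->
  bc0 g0 v0 y = 0 -> bc1 g1 v1 y = 0 -> forall z, I01 z -> y z = 0.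
Proof.
move=> h b0 b1 z Iz; apply/eqP; apply: contraT => yz.
have [n ln] : exists n, lam n = 0 by apply: SLsol_eigenvalue h b0 b1 _; exists z.
by have := lam_gt0 n; rewrite ln ltxx.
Qed.

Lemma bc0_comb (y v : R -> R) l F G w x c : SLsol l F y w -> SLsol l G v x ->
  bc0 g0 v0 (fun z => y z + c * v z) = bc0 g0 v0 y + c * bc0 g0 v0 v /\
  bc1 g1 v1 (fun z => y z + c * v z) = bc1 g1 v1 y + c * bc1 g1 v1 v.
Proof.
move=> h k; have hk := SLsol_comb c h k.
rewrite /bc0 /bc1 !(SLsol_D01 hk) ?(SLsol_D01 h) ?(SLsol_D01 k);
  do ?[exact: I01_0|exact: I01_1].
by split; ring.
Qed.

(** Shooting: the value of the right boundary form at psi is nonzero, for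
  otherwise psi would be an eigenfunction for 0; so a multiple of psi corrects a
  solution that has the prescribed left boundary value. *)
Lemma bvp_exists F a b : C0_on I01 F ->
  exists y w, [/\ SLsol 0 F y w, bc0 g0 v0 y = a & bc1 g1 v1 y = b].
Proof.
move=> Fc; have [psi [x [k k0 x0 b0]]] := shooting_solution 0.
have p0 : p 0 != 0 by apply: p_neq0; exact: I01_0.
have B0 : bc1 g1 v1 psi != 0.
  apply/eqP => b1; have psi0 := SLsol_unique0 k b0 b1.
  have v00 : v0 = 0 by rewrite -k0 psi0//; exact: I01_0.
  have : x 0 = 0.
    apply/eqP; have : D01 psi 0 = 0.
      apply: is_D_D01; first exact: I01_0.
      apply: (is_D_ext I01_0 (fun y Iy => esym (psi0 y Iy))); exact: is_D_cst.
    by rewrite (SLsol_D01 k I01_0) => /eqP; rewrite mulf_eq0 invr_eq0 (negbTE p0) orbF.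
  rewrite x0 => /eqP; rewrite oppr_eq0 mulf_eq0 (negbTE p0) /= => /eqP g00.
  by have := N0_gt0; rewrite /N0 v00 g00 expr0n addr0 ltxx.
have [y [w [h y0 w0]]] := SLsol_exists 0 (a * g0 / N0) (p 0 * (a * v0 / N0)) Fc.
have yb : bc0 g0 v0 y = a.
  rewrite /bc0 (SLsol_D01 h I01_0) y0 w0.
  have := lt0r_neq0 N0_gt0; rewrite /N0 => n0.
  by field; rewrite n0 p0.
pose c := (b - bc1 g1 v1 y) / bc1 g1 v1 psi.
have [c0 c1] := bc0_comb c h k.
exists (fun z => y z + c * psi z), (fun z => w z + c * x z); split.
- have := SLsol_comb c h k.
  have -> : (fun z => F z + c * (fun=> 0) z) = F.
    by apply/funext => z; rewrite /= mulr0 addr0.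
  by [].
- by rewrite c0 b0 mulr0 addr0.
- by rewrite c1 /c divfK// addrC subrK.
Qed.

(** As v satisfies the homogeneous conditions, (v, v') is a multiple of
  (v0, - g0) at 0 and of (v1, - g1) at 1, so the boundary terms of Green's
  identity read only the boundary values of y. *)
Lemma boundary_pairing F G l m y w v x :
  SLsol l F y w -> SLsol m G v x -> bc0 g0 v0 v = 0 -> bc1 g1 v1 v = 0 ->
  (w 1 * v 1 - y 1 * x 1) - (w 0 * v 0 - y 0 * x 0) =
    p 1 / N1 * (v1 * v 1 - g1 * D01 v 1) * bc1 g1 v1 y +
    p 0 / N0 * (g0 * D01 v 0 - v0 * v 0) * bc0 g0 v0 y.
Proof.
move=> h k b0 b1.
have p0 : p 0 != 0 by apply: p_neq0; exact: I01_0.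
have p1 : p 1 != 0 by apply: p_neq0; exact: I01_1.
have n0 := lt0r_neq0 N0_gt0; have n1 := lt0r_neq0 N1_gt0.
have -> : w 1 = p 1 * D01 y 1 by rewrite (SLsol_D01 h I01_1) mulrC divfK.
have -> : w 0 = p 0 * D01 y 0 by rewrite (SLsol_D01 h I01_0) mulrC divfK.
have -> : x 1 = p 1 * D01 v 1 by rewrite (SLsol_D01 k I01_1) mulrC divfK.
have -> : x 0 = p 0 * D01 v 0 by rewrite (SLsol_D01 k I01_0) mulrC divfK.
have e0 : N0 * (D01 y 0 * v 0 - y 0 * D01 v 0) =
    (v0 * v 0 - g0 * D01 v 0) * bc0 g0 v0 y.
  have -> : N0 * (D01 y 0 * v 0 - y 0 * D01 v 0) =
    (v0 * v 0 - g0 * D01 v 0) * bc0 g0 v0 y +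
    bc0 g0 v0 v * (g0 * D01 y 0 - v0 * y 0) by rewrite /N0 /bc0; ring.
  by rewrite b0 mul0r addr0.
have e1 : N1 * (D01 y 1 * v 1 - y 1 * D01 v 1) =
    (v1 * v 1 - g1 * D01 v 1) * bc1 g1 v1 y.
  have -> : N1 * (D01 y 1 * v 1 - y 1 * D01 v 1) =
    (v1 * v 1 - g1 * D01 v 1) * bc1 g1 v1 y +
    bc1 g1 v1 v * (g1 * D01 y 1 - v1 * y 1) by rewrite /N1 /bc1; ring.
  by rewrite b1 mul0r addr0.
rewrite (_ : _ - _ = p 1 / N1 * (N1 * (D01 y 1 * v 1 - y 1 * D01 v 1))
  - p 0 / N0 * (N0 * (D01 y 0 * v 0 - y 0 * D01 v 0))).
  by rewrite e0 e1; ring.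
by field; rewrite n0 n1.
Qed.

(** The weights with which the boundary data enter the n-th coefficient. *)
Definition beta0 n := p 0 / N0 * (g0 * D01 (phi n) 0 - v0 * phi n 0).
Definition beta1 n := p 1 / N1 * (v1 * phi n 1 - g1 * D01 (phi n) 1).

(** Green's identity against an eigenfunction.  For a profile of the evolution F
  contains the time derivative, for a stationary solution it vanishes. *)
Lemma green_phi n F y w : C0_on I01 F -> SLsol 0 F y w ->
  lam n * ip y (phi n) + J (fun z => F z * phi n z) =
    beta1 n * bc1 g1 v1 y + beta0 n * bc0 g0 v0 y.
Proof.
move=> Fc h; have [b0 b1] := phi_bc n; have [yc _] := SLsol_C0 h.
rewrite /beta0 /beta1 -(boundary_pairing h (phi_sol n) b0 b1).
rewrite -(SLsol_green Fc (C0_on_cst I01 0) h (phi_sol n)) -J_Z; last first.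
  by apply: ip_C0 => //; exact: phi_C0.
rewrite -J_D; first by apply: eq_J => z _; rewrite subr0 mulr0 subr0.
  by apply: C0_onM; [exact: C0_on_cst|apply: ip_C0 => //; exact: phi_C0].
by apply: C0_onM => //; exact: phi_C0.
Qed.

Lemma phi_orthogonal n m : n != m -> ip (phi n) (phi m) = 0.
Proof.
move=> nm; have [b0 b1] := phi_bc m; have [c0 c1] := phi_bc n.
have := SLsol_green (C0_on_cst I01 0) (C0_on_cst I01 0) (phi_sol n) (phi_sol m).
rewrite (boundary_pairing (phi_sol n) (phi_sol m) b0 b1) c0 c1 !mulr0 addr0.
rewrite (eq_J (g := fun z => (lam m - lam n) * (r z * (phi n z * phi m z)))); last first.
  by move=> z _; rewrite mul0r mulr0 subr0 addr0.
rewrite J_Z; last by apply: ip_C0; exact: phi_C0.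
move/eqP; rewrite mulf_eq0 => /orP[|/eqP//].
case: lam_phi => inc _ _; rewrite subr_eq0.
by move: nm; rewrite neq_ltn => /orP[] /inc h; rewrite (gt_eqF h, lt_eqF h).
Qed.

(** On the orthogonal complement of the eigenfunctions the resolvent is
  bounded for every real l: subtract from y the multiple of the shooting
  solution psi that cancels the initial data and estimate the rest by
  Gronwall.  If psi satisfies the right boundary condition, it is an
  eigenfunction, hence orthogonal to y; otherwise the right boundary condition
  of y bounds the multiple. *)
Lemma resolvent_bound l : exists2 K, 0 <= K & forall G y w, C0_on I01 G ->
  SLsol l (fun z => r z * G z) y w -> bc0 g0 v0 y = 0 -> bc1 g1 v1 y = 0 ->
  (forall n, ip y (phi n) = 0) -> ip y y <= K * ip G G.
Proof.
have [K K0 hK] := SLsol_gronwall l.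
have [psi [x [k k0 x0 pb0]]] := shooting_solution l.
have [psic _] := SLsol_C0 k.
have Jr := J_r_ge0.
have [B0|B0] := eqVneq (bc1 g1 v1 psi) 0.
  exists (K * J r); first exact: mulr_ge0.
  move=> G y w Gc h b0 b1 orth.
  have [yc _] := SLsol_C0 h.
  have [c [a_sol a0 aw0]] := SLsol_shift h b0 k k0 x0.
  set a := (fun z => y z - _) in a_sol; have [ac _] := SLsol_C0 a_sol.
  have aG : ip a a <= K * J r * ip G G.
    rewrite mulrAC; apply: ip_sqr_le => // z Iz.
    exact: (hK _ _ _ Gc a_sol a0 aw0 z Iz).1.
  have ypsi : ip y psi = 0.
    have [psi0|psi0] := pselect (exists2 z, I01 z & psi z != 0); last first.
      rewrite -[RHS](J_cst 0); apply: eq_J => z Iz.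
      have [->|pz] := eqVneq (psi z) 0; first by rewrite !mulr0.
      by exfalso; apply: psi0; exists z.
    have [n ln] := SLsol_eigenvalue k pb0 B0 psi0.
    have phn := phi_sol n; rewrite ln in phn.
    have [d [d_sol d0 dw0]] := SLsol_shift phn (phi_bc n).1 k k0 x0.
    have phid z : I01 z -> phi n z = d * psi z.
      by move=> Iz; apply/eqP; rewrite -subr_eq0; apply/eqP; apply: (gronwall0 d_sol d0 dw0).
    have := orth n; rewrite (eq_ip (fun z _ => erefl (y z)) phid) ipC ipZ//.
    move/eqP; rewrite mulf_eq0 => /orP[/eqP dz|/eqP]; last by rewrite ipC.
    exfalso; have := phi_norm n; rewrite (eq_ip phid phid) ipZ//; last first.
      by apply: C0_onM => //; exact: C0_on_cst.
    by rewrite dz mul0r => /eqP; rewrite eq_sym oner_eq0.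
  have : ip y y = ip a y.
    rewrite ipB//; last by apply: C0_onM => //; exact: C0_on_cst.
    by rewrite ipZ// (ipC psi) ypsi mulr0 subr0.
  have := ip_young ac yc; lra.
pose B := bc1 g1 v1 psi.
have p1 : 0 < p 1 by apply: p_gt0; exact: I01_1.
pose M := 2 * (g1 ^+ 2 + (v1 / p 1) ^+ 2) * K / B ^+ 2.
have M0 : 0 <= M.
  by rewrite divr_ge0 ?sqr_ge0// mulr_ge0// mulr_ge0// addr_ge0// sqr_ge0.
exists (2 * (K * J r) + 2 * M * ip psi psi).
  by rewrite addr_ge0 ?(mulr_ge0 _ (ip_ge0 psi)) ?(mulr_ge0 _ M0) ?(mulr_ge0 _ (mulr_ge0 K0 Jr)).
move=> G y w Gc h b0 b1 _.
have [yc _] := SLsol_C0 h.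
have [c [a_sol a0 aw0]] := SLsol_shift h b0 k k0 x0.
set a := (fun z => y z - _) in a_sol; have [ac _] := SLsol_C0 a_sol.
have aG : ip a a <= K * J r * ip G G.
  rewrite mulrAC; apply: ip_sqr_le => // z Iz.
  exact: (hK _ _ _ Gc a_sol a0 aw0 z Iz).1.
have cB : c * B = - (g1 * a 1 + v1 / p 1 * (w 1 - c * x 1)).
  have := b1; rewrite /B /bc1 (SLsol_D01 h I01_1) (SLsol_D01 k I01_1) /a => e.
  by apply/eqP; rewrite -addr_eq0; apply/eqP; rewrite -[RHS]e; field; rewrite gt_eqF.
have [a1 w1] := hK _ _ _ Gc a_sol a0 aw0 1 I01_1.
have cM : c ^+ 2 <= M * ip G G.
  have B2 : 0 < B ^+ 2 by rewrite exprn_even_gt0.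
  rewrite /M mulrAC ler_pdivlMr// -exprMn cB sqrrN.
  set u := g1 * a 1; set s := v1 / p 1 * (w 1 - c * x 1).
  have : (u + s) ^+ 2 <= 2 * (u ^+ 2 + s ^+ 2) by have := sqr_ge0 (u - s); nra.
  have : u ^+ 2 <= g1 ^+ 2 * (K * ip G G) by rewrite exprMn ler_wpM2l// sqr_ge0.
  have : s ^+ 2 <= (v1 / p 1) ^+ 2 * (K * ip G G) by rewrite exprMn ler_wpM2l// sqr_ge0.
  lra.
have cpc : C0_on I01 (fun z => c * psi z) by apply: C0_onM => //; exact: C0_on_cst.
have e1 : ip y y = ip a y + ip (fun z => c * psi z) y.
  by rewrite -ipD//; apply: eq_ip => // z _; rewrite subrK.
have e2 : ip (fun z => c * psi z) (fun z => c * psi z) = c ^+ 2 * ip psi psi.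
  by rewrite ipZ// ipC ipZ// mulrA expr2.
have e3 : ip a y = ip a a + ip (fun z => c * psi z) a.
  by rewrite [LHS]ipC -ipD//; apply: eq_ip => // z _; rewrite subrK.
have e4 : ip (fun z => c * psi z) y = ip a (fun z => c * psi z) + c ^+ 2 * ip psi psi.
  by rewrite -e2 [LHS]ipC -ipD//; apply: eq_ip => // z _; rewrite subrK.
have := ip_young ac cpc.
have : c ^+ 2 * ip psi psi <= M * ip G G * ip psi psi by rewrite ler_wpM2r// ip_ge0.
rewrite (ipC (fun z => c * psi z) a) in e3 *; lra.
Qed.

(** * Completeness of the eigenfunctions *)

(** The graph of the inverse of the Sturm-Liouville operator A: y lies in the
  domain of A and A y = f. *)
Definition SLinv (f y : R -> R) : Prop := exists w,
  [/\ SLsol 0 (fun z => - (r z * f z)) y w, bc0 g0 v0 y = 0 & bc1 g1 v1 y = 0].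

Definition SLorth (f : R -> R) : Prop :=
  C0_on I01 f /\ forall n, ip f (phi n) = 0.

Lemma SLinv_C0 f y : SLinv f y -> C0_on I01 y.
Proof. by move=> [w [/SLsol_C0[]]]. Qed.

Lemma source_C0 f : C0_on I01 f -> C0_on I01 (fun z => - (r z * f z)).
Proof. by move=> fc; apply: C0_onN; exact: C0_onM. Qed.

Lemma SLinv_exists f : C0_on I01 f -> exists y, SLinv f y.
Proof.
move=> /source_C0 fc; have [y [w [h b0 b1]]] := bvp_exists 0 0 fc.
by exists y, w.
Qed.

Lemma SLinv_comb f f' y y' c : SLinv f y -> SLinv f' y' ->
  SLinv (fun z => f z + c * f' z) (fun z => y z + c * y' z).
Proof.
move=> [w [h b0 b1]] [w' [h' b0' b1']].
have [e0 e1] := bc0_comb c h h'.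
exists (fun z => w z + c * w' z); split.
- have := SLsol_comb c h h'.
  have -> // : (fun z => - (r z * f z) + c * - (r z * f' z)) =
    (fun z => - (r z * (f z + c * f' z))).
  by apply/funext => z; ring.
- by rewrite e0 b0 b0' mulr0 addr0.
- by rewrite e1 b1 b1' mulr0 addr0.
Qed.

Lemma SLinv_coef f y n : C0_on I01 f -> SLinv f y ->
  lam n * ip y (phi n) = ip f (phi n).
Proof.
move=> fc [w [h b0 b1]]; have := green_phi n (source_C0 fc) h.
rewrite b0 b1 !mulr0 addr0 => /eqP; rewrite addr_eq0 => /eqP ->.
have pc : C0_on I01 (phi n) by exact: phi_C0.
rewrite -mulN1r -J_Z; last by apply: C0_onM => //; exact: source_C0.
by apply: eq_J => z _; ring.
Qed.

Lemma SLinv_orth f y : SLorth f -> SLinv f y -> SLorth y.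
Proof.
move=> [fc fo] h; split; first exact: SLinv_C0 h.
move=> n; have := SLinv_coef n fc h; rewrite fo => /eqP.
by rewrite mulf_eq0 (gt_eqF (lam_gt0 n)) /= => /eqP.
Qed.

(** The inverse is symmetric, since Green's identity has no boundary terms on the
  domain of A. *)
Lemma SLinv_sym f y f' y' : C0_on I01 f -> C0_on I01 f' ->
  SLinv f y -> SLinv f' y' -> ip y f' = ip f y'.
Proof.
move=> fc fc' [w [h b0 b1]] [w' [h' b0' b1']].
have [yc _] := SLsol_C0 h; have [yc' _] := SLsol_C0 h'.
have := SLsol_green (source_C0 fc) (source_C0 fc') h h'.
rewrite (boundary_pairing h h' b0' b1') b0 b1 !mulr0 addr0.
rewrite (eq_J (g := fun z => r z * (y z * f' z) - r z * (f z * y' z))); last first.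
  by move=> z _; ring.
by rewrite J_B; do ?exact: ip_C0; move/eqP; rewrite subr_eq0 => /eqP.
Qed.

Lemma SLinv_eq0 f y : C0_on I01 f -> SLinv f y ->
  (forall z, I01 z -> y z = 0) -> forall z, I01 z -> f z = 0.
Proof.
move=> fc [w [h _ _]] y0 z Iz.
have w0 x : I01 x -> 0 = w x.
  move=> Ix; have : D01 y x = 0.
    apply: is_D_D01 => //; apply: (is_D_ext Ix (fun s Is => esym (y0 s Is))).
    exact: is_D_cst.
  rewrite (SLsol_D01 h Ix) => /eqP; rewrite mulf_eq0 invr_eq0.
  by rewrite (negbTE (p_neq0 Ix)) orbF => /eqP.
have := (h z Iz).2; rewrite y0// mulr0 add0r => wD.
have := is_D_unique Iz wD (is_D_ext Iz w0 (is_D_cst _ _ _)).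
by move/eqP; rewrite oppr_eq0 mulf_eq0 (gt_eqF (r_gt0 Iz)) => /eqP.
Qed.

Lemma ip_split (f g h : R -> R) c : C0_on I01 g -> C0_on I01 h ->
  (forall z, I01 z -> f z = c * (g z - h z)) ->
  ip f f <= 2 * c ^+ 2 * (ip g g + ip h h).
Proof.
move=> gc hc fE.
have fc : C0_on I01 (fun z => c * (g z - h z)).
  by apply: C0_onM; [exact: C0_on_cst|exact: C0_onB].
have c1 : C0_on I01 (fun z => 2 * c ^+ 2 * (r z * (g z * g z))).
  by apply: C0_onM; [exact: C0_on_cst|exact: ip_C0].
have c2 : C0_on I01 (fun z => 2 * c ^+ 2 * (r z * (h z * h z))).
  by apply: C0_onM; [exact: C0_on_cst|exact: ip_C0].
rewrite (eq_ip fE fE) mulrDr -!J_Z -?J_D//; do ?exact: ip_C0.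
apply: le_J; [exact: ip_C0|exact: C0_onD|].
move=> z Iz; rewrite -mulrDr -mulrDr [leRHS]mulrCA ler_pM2l ?r_gt0//.
have := sqr_ge0 (c * (g z + h z)); nra.
Qed.

(** In terms of g = y - m f, the equation A y = f becomes (A - 1 / m) y = - g / m,
  to which the resolvent bound applies; f is then recovered from y and g. *)
Lemma SLinv_lower_bound m : m != 0 -> exists2 K, 0 <= K &
  forall f y, SLorth f -> SLinv f y ->
    ip f f <= K * ip (fun z => y z - m * f z) (fun z => y z - m * f z).
Proof.
move=> m0; have [K K0 hK] := resolvent_bound m^-1.
exists (2 * m^-1 ^+ 2 * (K * m^-1 ^+ 2 + 1)).
  have m2 : 0 <= m^-1 ^+ 2 by exact: sqr_ge0.
  by apply: mulr_ge0; [exact: mulr_ge0|apply: addr_ge0 => //; exact: mulr_ge0].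
move=> f y [fc fo] h; have [yc yo] := SLinv_orth (conj fc fo) h.
pose g z := y z - m * f z.
have gc : C0_on I01 g by apply: C0_onB => //; apply: C0_onM => //; exact: C0_on_cst.
have mgc : C0_on I01 (fun z => m^-1 * g z) by apply: C0_onM => //; exact: C0_on_cst.
have [w [hw b0 b1]] := h.
have hw' : SLsol m^-1 (fun z => r z * (m^-1 * g z)) y w.
  move=> z Iz; have [h1 h2] := hw z Iz; split => //.
  rewrite (_ : _ + _ = (q z - 0 * r z) * y z + - (r z * f z))//.
  by rewrite /g; field.
have yg : ip y y <= K * m^-1 ^+ 2 * ip g g.
  have := hK _ _ _ mgc hw' b0 b1 yo.
  by rewrite ipZ// ipC ipZ// !mulrA -(mulrA K) -expr2.
have : ip f f <= 2 * m^-1 ^+ 2 * (ip y y + ip g g).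
  by apply: ip_split => // z _; rewrite /g; field.
move=> /le_trans; apply; rewrite -/g -[leRHS]mulrA.
apply: ler_wpM2l; last by lra.
by rewrite mulr_ge0//; exact: sqr_ge0.
Qed.

(** A^-2 - s factors as (A^-1 + m) (A^-1 - m) with m^2 = s. *)
Lemma SLinv2_lower_bound s : 0 < s -> exists2 K, 0 <= K &
  forall f y1 y2, SLorth f -> SLinv f y1 -> SLinv y1 y2 ->
    ip f f <= K * ip (fun z => y2 z - s * f z) (fun z => y2 z - s * f z).
Proof.
move=> s0; pose m := Num.sqrt s.
have m0 : m != 0 by rewrite gt_eqF// sqrtr_gt0.
have nm0 : - m != 0 by rewrite oppr_eq0.
have [K K0 hK] := SLinv_lower_bound m0.
have [K' K'0 hK'] := SLinv_lower_bound nm0.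
exists (K' * K); first exact: mulr_ge0.
move=> f y1 y2 fo h1 h2.
have y1o := SLinv_orth fo h1.
have go : SLorth (fun z => y1 z + m * f z).
  case: fo y1o => fc fo [y1c y1o].
  have mfc : C0_on I01 (fun z => m * f z) by apply: C0_onM => //; exact: C0_on_cst.
  split; first exact: C0_onD.
  have pc n : C0_on I01 (phi n) by exact: phi_C0.
  by move=> n; rewrite ipD// ipZ// fo y1o mulr0 addr0.
have e2 := hK _ _ go (SLinv_comb m h2 h1).
have e1 := hK' _ _ fo h1.
have E1 z : I01 z -> y1 z - - m * f z = y1 z + m * f z by rewrite mulNr opprK.
have E2 z : I01 z -> y2 z + m * y1 z - m * (y1 z + m * f z) = y2 z - s * f z.
  by rewrite -[s](sqr_sqrtr (ltW s0)) -/m => _; ring.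
rewrite (eq_ip E1 E1) in e1; rewrite (eq_ip E2 E2) in e2.
by rewrite (le_trans e1)// -mulrA ler_wpM2l.
Qed.

(** Completeness of the eigenfunctions, by the power method.  The ratios of
  the squared norms of the iterates of the inverse operator increase to a
  limit s, which makes the iterates approximate eigenvectors of the square of
  the inverse for s; the lower bound above rules this out. *)
Lemma SLorth_eq0 h : SLorth h -> forall z, I01 z -> h z = 0.
Proof.
move=> ho.
have [T hT] : exists T, forall f, C0_on I01 f -> SLinv f (T f).
  have ex f : exists y, C0_on I01 f -> SLinv f y.
    have [fc|nfc] := pselect (C0_on I01 f); last by exists f.
    by have [y hy] := SLinv_exists fc; exists y.
  by have [T hT] := choice ex; exists T.
pose f k := iter k T h.
have fo k : SLorth (f k).
  by elim: k => [//|k IH]; apply: SLinv_orth (IH) (hT _ IH.1).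
have fT k : SLinv (f k) (f k.+1) by apply: hT; exact: (fo k).1.
pose a k := ip (f k) (f k).
have [a0|a0] := eqVneq (a 0%N) 0; first by apply: ip_eq0 a0; exact: ho.1.
have a_gt0 k : 0 < a k.
  elim: k => [|k IH]; first by rewrite lt_def a0 ip_ge0.
  rewrite lt_def ip_ge0 andbT; apply/eqP => ak.
  have := SLinv_eq0 (fo k).1 (fT k) (ip_eq0 (fo k.+1).1 ak) => fk0.
  have : a k = 0.
    rewrite /a (eq_ip (f' := fun=> 0) (g' := fun=> 0))// -[RHS](J_cst 0).
    by apply: eq_J => z _; rewrite /= !mulr0.
  by move=> ak0; move: IH; rewrite ak0 ltxx.
pose rho k := a k.+1 / a k.
(* Symmetry moves one application of the inverse to the other side; with
   Cauchy-Schwarz the ratios are nondecreasing. *)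
have aS k : a k.+1 = ip (f k.+2) (f k).
  by rewrite [RHS](SLinv_sym (fo k.+1).1 (fo k).1 (fT k.+1) (fT k)).
have rho_incr k : rho k <= rho k.+1.
  rewrite /rho ler_pdivrMr// mulrAC ler_pdivlMr// -expr2 {1}aS.
  exact: ip_cauchy_schwarz (fo k.+2).1 (fo k).1.
have [K K0 hK] := resolvent_bound 0.
have rho_le k : rho k <= K.
  rewrite /rho ler_pdivrMr//.
  have [w [hw b0 b1]] := fT k.
  have Nfc : C0_on I01 (fun z => - f k z) by apply: C0_onN; exact: (fo k).1.
  have hw' : SLsol 0 (fun z => r z * - f k z) (f k.+1) w.
    by move=> z Iz; have := hw z Iz; rewrite mulrN.
  have := hK _ _ _ Nfc hw' b0 b1 (fo k.+1).2.
  rewrite (_ : ip (fun z => - f k z) _ = a k)//.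
  by apply: eq_J => z _; rewrite mulrNN.
pose s := sup (range rho).
have rho_sup : has_sup (range rho).
  by split; [exists (rho 0%N), 0%N|exists K => _ [k _ <-]].
have rho_s k : rho k <= s by apply: ub_le_sup; [exact: rho_sup.2|exists k].
have s0 : 0 < s by rewrite (lt_le_trans _ (rho_s 0%N))// divr_gt0.
have [C C0 hC] := SLinv2_lower_bound s0.
(* The square norm of f k.+2 - s f k is a k times
   rho k.+1 rho k - 2 s rho k + s^2, which is at most s (s - rho k). *)
have key k : 1 <= C * (s * (s - rho k)).
  have := hC _ _ _ (fo k) (fT k) (fT k.+1).
  have fkc := (fo k).1; have fk2c := (fo k.+2).1.
  have sfc : C0_on I01 (fun z => s * f k z) by apply: C0_onM => //; exact: C0_on_cst.
  have dc : C0_on I01 (fun z => f k.+2 z - s * f k z) by exact: C0_onB.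
  rewrite ipB// ipZ// (ipC _ (fun z => _ - _)) ipB// ipZ//.
  rewrite (ipC (f k) (fun z => _ - _)) ipB// ipZ// -/(a k) -/(a k.+2) -aS (ipC (f k)) -aS.
  have r1 : a k.+1 = rho k * a k by rewrite /rho divfK// gt_eqF.
  have r2 : a k.+2 = rho k.+1 * (rho k * a k).
    by rewrite -r1 /rho divfK// gt_eqF.
  rewrite r2 r1.
  have -> : rho k.+1 * (rho k * a k) - s * (rho k * a k) -
      s * (rho k * a k - s * a k) =
      a k * (rho k.+1 * rho k - 2 * s * rho k + s ^+ 2) by ring.
  rewrite mulrCA -{1}[a k]mulr1 ler_pM2l// => /le_trans; apply.
  rewrite ler_wpM2l//.
  have rk0 : 0 <= rho k by rewrite divr_ge0// ltW.
  have : rho k.+1 * rho k <= s * rho k by rewrite ler_wpM2r.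
  lra.
have Cs0 : 0 < C * s + 1 by rewrite ltr_wpDl// mulr_ge0// ltW.
have [_ [k _ <-] hk] := sup_adherent (divr_gt0 ltr01 Cs0) rho_sup.
exfalso; have := key k; rewrite -/s in hk.
have : s - rho k < (C * s + 1)^-1 by move: hk; rewrite div1r; lra.
rewrite -[X in _ < X]div1r ltr_pdivlMr// => e1.
have := rho_s k => e2; nra.
Qed.

(** * Eigenfunction expansions *)

(** Each step subtracts a coefficient of f itself, which by orthogonality is also
  the coefficient of the preceding remainder. *)
Fixpoint remainder (f : R -> R) N : R -> R :=
  if N is N'.+1 then
    fun z => remainder f N' z - ip f (phi N') * phi N' z
  else f.

Lemma remainder_C0 f N : C0_on I01 f -> C0_on I01 (remainder f N).
Proof.
move=> fc; elim: N => [//|N IH] /=; apply: C0_onB => //.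
by apply: C0_onM; [exact: C0_on_cst|exact: phi_C0].
Qed.

Lemma remainder_coef f N m : C0_on I01 f ->
  ip (remainder f N) (phi m) = if (m < N)%N then 0 else ip f (phi m).
Proof.
move=> fc; elim: N => [//|N IH] /=.
have pc n : C0_on I01 (phi n) by exact: phi_C0.
have rc := @remainder_C0 _ N fc.
rewrite ipB//; last by apply: C0_onM => //; exact: C0_on_cst.
rewrite ipZ// IH ltnS [(m <= N)%N]leq_eqVlt; have [->|mN] /= := eqVneq m N.
  by rewrite ltnn phi_norm mulr1 subrr.
by rewrite phi_orthogonal 1?eq_sym// mulr0 subr0.
Qed.

Lemma remainder_norm f N : C0_on I01 f ->
  ip (remainder f N) (remainder f N) =
    ip f f - series (fun n => ip f (phi n) ^+ 2) N.
Proof.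
move=> fc; elim: N => [|N IH]; first by rewrite /series /= big_geq// subr0.
rewrite seriesSr opprD addrA -IH /=.
have pc n : C0_on I01 (phi n) by exact: phi_C0.
have rc := @remainder_C0 _ N fc.
have zc : C0_on I01 (fun z => ip f (phi N) * phi N z) by apply: C0_onM => //; exact: C0_on_cst.
have dc : C0_on I01 (fun z => remainder f N z - ip f (phi N) * phi N z) by exact: C0_onB.
rewrite ipB// ipZ// ipC ipB// ipZ// (ipC (phi N) (fun z => _ - _)) ipB// ipZ//.
by rewrite (ipC (phi N) (remainder _ _)) remainder_coef// ltnn phi_norm; ring.
Qed.

Lemma bessel f N : C0_on I01 f ->
  series (fun n => ip f (phi n) ^+ 2) N <= ip f f.
Proof. by move=> fc; rewrite -subr_ge0 -remainder_norm// ip_ge0. Qed.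

Lemma remainder_nincr f N M : C0_on I01 f -> (N <= M)%N ->
  ip (remainder f M) (remainder f M) <= ip (remainder f N) (remainder f N).
Proof.
move=> fc /subnKC <-; elim: (M - N)%N => [|k IH]; first by rewrite addn0.
rewrite (le_trans _ IH)// addnS !remainder_norm// seriesSr lerD2l lerN2 lerDl.
exact: sqr_ge0.
Qed.

Lemma remainderD f g N z : C0_on I01 f -> C0_on I01 g ->
  remainder (fun z => f z + g z) N z = remainder f N z + remainder g N z.
Proof.
move=> fc gc; elim: N => [//|N IH] /=.
have pc : C0_on I01 (phi N) by exact: phi_C0.
by rewrite IH (ipD fc gc pc); ring.
Qed.

Lemma parseval_of_remainder f : C0_on I01 f ->
  (forall e, 0 < e -> exists N, ip (remainder f N) (remainder f N) <= e) ->
  series (fun n => ip f (phi n) ^+ 2) @ \oo --> ip f f.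
Proof.
move=> fc h; apply/cvgrPdist_le => e e0; have [N hN] := h e e0.
exists N => // M /= NM.
rewrite -remainder_norm// ger0_norm ?ip_ge0//.
by rewrite (le_trans _ hN)//; exact: remainder_nincr.
Qed.

Hypothesis phi_summable : cvgn (series (fun n =>
  (lam n)^-1 * max_on I01 (fun z => `|phi n z|))).

Lemma phi_le_max n z : I01 z -> `|phi n z| <= max_on I01 (fun z => `|phi n z|).
Proof.
rewrite I01E => Iz; apply: (@max_on_ge _ 0 1 (fun z => `|phi n z|)) => //.
by apply: C0_on_normr; exact: phi_C0.
Qed.

(** In the domain of the operator the expansion converges uniformly, since
  the coefficients of f are those of A f divided by the eigenvalues; its sum is
  f by completeness. *)
Lemma remainder_dom f : C2_on I01 f -> bc0 g0 v0 f = 0 -> bc1 g1 v1 f = 0 ->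
  forall e, 0 < e -> exists N, ip (remainder f N) (remainder f N) <= e.
Proof.
move=> f2 b0 b1.
have fc : C0_on I01 f by case: f2 => [[]].
pose g z := (q z * f z - D01 (fun z => p z * D01 f z) z) / r z.
have gc : C0_on I01 g.
  apply: C0_onM.
    by apply: C0_onB; [exact: C0_onM|exact: C2_flux_C0].
  by apply: C0_onV => // z Iz; rewrite gt_eqF// r_gt0.
have gf : SLinv g f.
  exists (fun z => p z * D01 f z); split => //.
  apply: C2_SLsol => // z Iz; rewrite /g.
  by field; rewrite gt_eqF// r_gt0.
pose K := Num.sqrt (ip g g).
have cK n : `|ip f (phi n)| <= K * (lam n)^-1.
  have l0 := lam_gt0 n.
  have -> : ip f (phi n) = ip g (phi n) / lam n.
    by rewrite -(SLinv_coef n gc gf) [lam n * _]mulrC mulfK// gt_eqF.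
  rewrite normrM [`|_^-1|]ger0_norm ?invr_ge0 ?(ltW l0)// ler_wpM2r ?invr_ge0 ?(ltW l0)//.
  rewrite -sqrtr_sqr ler_wsqrtr//.
  have pc : C0_on I01 (phi n) by exact: phi_C0.
  by have := ip_cauchy_schwarz gc pc; rewrite phi_norm mulr1.
pose M : R^nat := K *: (fun n => (lam n)^-1 * max_on I01 (fun z => `|phi n z|)).
have Mc : cvgn (series M).
  by rewrite -[series M]/(series (K *: _)) seriesZ; exact: is_cvgZr.
have step n z : I01 z -> `|remainder f n.+1 z - remainder f n z| <= M n.
  move=> Iz; rewrite /= addrC addKr normrN normrM.
  rewrite (_ : M n = K * (lam n)^-1 * max_on I01 (fun z => `|phi n z|)); last first.
    by rewrite -mulrA.
  by apply: ler_pM => //; exact: phi_le_max.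
have [h [T [hc T0 hT]]] := uniform_limit (fun n => @remainder_C0 _ n fc) step Mc.
have T2 : (fun n => T n ^+ 2 * J r) @ \oo --> 0.
  rewrite -(mul0r (J r)) -[X in X * _](mul0r 0).
  by under eq_fun do rewrite expr2; apply: cvgM; [exact: cvgM|exact: cvg_cst].
have hr n : ip (fun z => h z - remainder f n z) (fun z => h z - remainder f n z)
    <= T n ^+ 2 * J r.
  apply: ip_sqr_le; first by apply: C0_onB => //; exact: remainder_C0.
  move=> z Iz; rewrite -real_normK ?num_real//.
  have hz := hT n z Iz; have Tn0 : 0 <= T n by exact: le_trans hz.
  by apply: lerXn2r; rewrite ?nnegrE.
have ho : SLorth h.
  split => // m; apply/eqP; rewrite -sqrf_eq0 eq_le sqr_ge0 andbT.
  have pc : C0_on I01 (phi m) by exact: phi_C0.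
  have ev : \forall n \near \oo, ip h (phi m) ^+ 2 <= T n ^+ 2 * J r.
    exists m.+1 => // n /= mn.
    have rc := @remainder_C0 _ n fc.
    have hrc : C0_on I01 (fun z => h z - remainder f n z) by exact: C0_onB.
    have -> : ip h (phi m) = ip (fun z => h z - remainder f n z) (phi m).
      by rewrite ipB// remainder_coef// mn subr0.
    rewrite (le_trans (ip_cauchy_schwarz hrc pc))// phi_norm mulr1.
    exact: hr.
  exact: (ler_cvg_to (cvg_cst _) T2 ev).
have h0 := SLorth_eq0 ho.
move=> e e0; move/cvgrPdist_le : T2 => /(_ e e0) [N _ hN]; exists N.
have := hN N (leqnn N); rewrite /= sub0r normrN => /(le_trans (ler_norm _)).
apply: le_trans; rewrite (le_trans _ (hr N))//.
rewrite (_ : ip (fun z => h z - _) _ = ip (remainder f N) (remainder f N))//.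
by apply: eq_J => z Iz; rewrite h0//; ring.
Qed.

(** Parseval's identity.  Multiplying by a cutoff moves f into the domain of
  the operator at a small cost in the weighted norm, and the remainder of the
  expansion is never larger than the function. *)
Lemma parseval f : C2_on I01 f ->
  series (fun n => ip f (phi n) ^+ 2) @ \oo --> ip f f.
Proof.
move=> f2; have fc : C0_on I01 f by case: f2 => [[]].
apply: parseval_of_remainder => // e e0.
have rfc : C0_on I01 (fun z => r z * f z ^+ 2) by apply: C0_onM => //; exact: C0_onX.
have [M M0 hM] := C0_on_bounded rfc.
have [k hk] : exists k, 4 * M * (2 * k).+1%:R^-1 <= e / 4.
  exists (Num.truncn (16 * M / e)).
  rewrite ler_pdivrMr ?ltr0n//.
  have h1 : 16 * M / e < (Num.truncn (16 * M / e)).+1%:R.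
    by rewrite truncnS_gt.
  set t := Num.truncn _ in h1 *.
  have h2 : (t.+1%:R : R) <= (2 * t).+1%:R by rewrite ler_nat ltnS leq_pmull.
  have : 16 * M / e < (2 * t).+1%:R by exact: lt_le_trans h1 h2.
  by rewrite ltr_pdivrMr//; lra.
pose f1 z := f z * cutoff k z; pose f3 z := f z * (1 - cutoff k z).
have f12 : C2_on I01 f1 by apply: C2_onM => //; exact: cutoff_C2.
have f1c : C0_on I01 f1 by case: f12 => [[]].
have f3c : C0_on I01 f3.
  have [[cc _ _] _] := @cutoff_C2 R k.
  by apply: C0_onM => //; apply: C0_onB => //; exact: C0_on_cst.
have fE z : f z = f1 z + f3 z by rewrite /f1 /f3; ring.
have [be0 be1] := @bump_endpoint R k.
have [c00 c01] := cutoff_mul_endpoint f2 (@I01_0 R) be0.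
have [c10 c11] := cutoff_mul_endpoint f2 (@I01_1 R) be1.
have b0 : bc0 g0 v0 f1 = 0 by rewrite /bc0 [f1 0]c00 [D01 _ _]c01 !mulr0 addr0.
have b1 : bc1 g1 v1 f1 = 0 by rewrite /bc1 [f1 1]c10 [D01 _ _]c11 !mulr0 addr0.
have f3n : ip f3 f3 <= e / 4.
  have bc : C0_on I01 (bump k) by case: (@bump_C2 R k) => [[]].
  apply: le_trans hk; rewrite -J_bump -J_Z//.
  apply: le_J; first exact: ip_C0.
    by apply: C0_onM => //; exact: C0_on_cst.
  move=> z Iz; have := bump_ge0 k z; have := bump_le1 k Iz.
  have := Iz; rewrite I01E => /hM; rewrite ger0_norm; last first.
    by rewrite mulr_ge0 ?sqr_ge0// ltW// r_gt0.
  rewrite /f3 /cutoff; set b := bump k z; set u := r z * f z ^+ 2 => uM b1' b0'.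
  have u0 : 0 <= u by rewrite mulr_ge0 ?sqr_ge0// ltW// r_gt0.
  rewrite (_ : r z * _ = u * (1 - (1 - b) ^+ 2) ^+ 2); last by rewrite /u; ring.
  have h1 : (1 - (1 - b) ^+ 2) ^+ 2 <= 4 * b by nra.
  have h2 : 0 <= (1 - (1 - b) ^+ 2) ^+ 2 by exact: sqr_ge0.
  by rewrite [leRHS](_ : _ = M * (4 * b)); [exact: ler_pM|ring].
have [N hN] := remainder_dom f12 b0 b1 (divr_gt0 e0 (ltr0Sn _ 3)).
exists N.
have r1c := @remainder_C0 _ N f1c; have r3c := @remainder_C0 _ N f3c.
have rE z : I01 z -> remainder f N z = 1 * (remainder f1 N z - (- 1 * remainder f3 N z)).
  move=> _; rewrite (_ : f = fun z => f1 z + f3 z); last exact/funext.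
  by rewrite remainderD//; ring.
have m3c : C0_on I01 (fun z => - 1 * remainder f3 N z) by apply: C0_onM => //; exact: C0_on_cst.
have := ip_split r1c m3c rE.
rewrite ipZ// ipC ipZ// mulrA mulrNN !mul1r expr1n.
have := remainder_nincr f3c (leq0n N); rewrite /=.
lra.
Qed.

(** * The gain constants *)

Let weight n := (lam n)^-1 * max_on I01 (fun z => `|phi n z|).

Lemma max_phi_ge0 n : 0 <= max_on I01 (fun z => `|phi n z|).
Proof. exact: le_trans (phi_le_max n I01_0). Qed.

Lemma weight_ge0 n : 0 <= weight n.
Proof. by rewrite mulr_ge0 ?max_phi_ge0// invr_ge0 ltW ?lam_gt0. Qed.

Lemma J_r_phi_le n : J (fun z => r z * `|phi n z|) <= max_on I01 (fun z => `|phi n z|) * J r.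
Proof.
have pc : C0_on I01 (phi n) by exact: phi_C0.
rewrite -J_Z//; apply: le_J.
- by apply: C0_onM => //; exact: C0_on_normr.
- by apply: C0_onM => //; exact: C0_on_cst.
- by move=> z Iz; rewrite mulrC ler_pM2r ?r_gt0// phi_le_max.
Qed.

Lemma J_r_phi_ge0 n : 0 <= J (fun z => r z * `|phi n z|).
Proof. by apply: J_ge0 => z Iz; rewrite mulr_ge0// ltW// r_gt0. Qed.

(** The terms are bounded by the squares of a multiple of a summable sequence, which
  is bounded by its sum. *)
Lemma termCt_cvg : cvgn (series (termCt r lam phi)).
Proof.
pose S := limn (series weight).
have aS n : weight n <= S.
  apply: le_trans (series_le_lim n.+1 weight_ge0 phi_summable).
  by rewrite seriesSr lerDr /series /= sumr_ge0// => k _; exact: weight_ge0.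
pose M : R^nat := (S * J r ^+ 2) *: weight.
have Mc : cvgn (series M) by rewrite seriesZ; exact: is_cvgZr.
apply: series_le_cvg Mc.
- by move=> n; rewrite mulr_ge0 ?sqr_ge0// invr_ge0 sqr_ge0.
- move=> n; rewrite mulr_ge0 ?weight_ge0// mulr_ge0 ?sqr_ge0//.
  exact: le_trans (weight_ge0 0%N) (aS 0%N).
- move=> n; have l0 := lam_gt0 n.
  have h := J_r_phi_le n; have h0 := J_r_phi_ge0 n.
  rewrite (_ : M n = S * weight n * J r ^+ 2); last by rewrite /M -[LHS]/(_ * _); ring.
  rewrite /termCt -exprVn -exprMn.
  have h1 : (lam n)^-1 * J (fun z => r z * `|phi n z|) <= weight n * J r.
    by rewrite /weight -mulrA ler_pM2l ?invr_gt0.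
  apply: (@le_trans _ _ ((weight n * J r) ^+ 2)).
    apply: lerXn2r => //; rewrite nnegrE; last exact: mulr_ge0 (weight_ge0 n) J_r_ge0.
    by rewrite mulr_ge0// invr_ge0 ltW.
  by rewrite exprMn ler_wpM2r ?sqr_ge0// expr2 ler_wpM2r ?weight_ge0.
Qed.

Lemma SLbvp_solution (a0 a1 : R) : exists f, [/\
  SLbvp_unique p q g0 v0 g1 v1 a0 a1 f, C2_on I01 f &
  forall n, lam n * ip f (phi n) = beta1 n * a1 + beta0 n * a0].
Proof.
have zc := C0_on_cst I01 (0 : R).
have [f [w [h b0 b1]]] := bvp_exists a0 a1 zc.
have f2 := SLsol_C2 zc h.
exists f; split => //.
  split.
    split => // z Iz; rewrite (is_D_D01 Iz (SLsol_flux h Iz)); ring.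
  move=> k [k2 keq k0 k1] z Iz.
  have ks : SLsol 0 (fun=> 0) k (fun z => p z * D01 k z).
    by apply: C2_SLsol => // x Ix; have := keq x Ix; lra.
  have d := SLsol_comb (- 1) ks h.
  have [e0 e1] := bc0_comb (- 1) ks h.
  have ds : SLsol 0 (fun=> 0) (fun z => k z + - 1 * f z) (fun z => p z * D01 k z + - 1 * w z).
    by move=> x Ix; have := d x Ix; rewrite /= mulr0 !addr0.
  have : k z + - 1 * f z = 0.
    apply: (SLsol_unique0 ds) => //.
      by rewrite e0 k0 b0; ring.
    by rewrite e1 k1 b1; ring.
  lra.
move=> n; rewrite -b0 -b1 -(green_phi n zc h).
rewrite (_ : J _ = 0) ?addr0// -[RHS](J_cst 0).
by apply: eq_J => z _; rewrite mul0r.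
Qed.

Lemma parseval_scaled f k (u : R^nat) : 0 < k -> C2_on I01 f ->
  (forall n, ip f (phi n) ^+ 2 = k * u n) ->
  cvgn (series u) /\ limn (series u) = ip f f / k.
Proof.
move=> k0 f2 fu.
have h : series u @ \oo --> k^-1 * ip f f.
  have -> : series u = (fun N => k^-1 * series (fun n => ip f (phi n) ^+ 2) N).
    apply/funext => N; rewrite /series /= mulr_sumr; apply: eq_bigr => n _.
    by rewrite fu mulKf// gt_eqF.
  by apply: cvgM; [exact: cvg_cst|exact: parseval].
split; first exact: cvgP h.
by rewrite mulrC; exact: cvg_lim h.
Qed.

(** Both constants are norms of stationary solutions, by Parseval: the
  coefficients of the stationary solution are the boundary data of the
  eigenfunctions divided by the eigenvalues. *)
Lemma stationary_constant (N c : R) (d : R^nat) f : 0 < N -> 0 < c ->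
  C2_on I01 f ->
  (forall n, lam n * ip f (phi n) = c / N * d n * Num.sqrt N) ->
  cvgn (series (fun n => (lam n ^+ 2)^-1 * `|d n| ^+ 2)) /\
  c / N * Num.sqrt (limn (series (fun n => (lam n ^+ 2)^-1 * `|d n| ^+ 2))) =
    (Num.sqrt N)^-1 * norm2 r f.
Proof.
move=> N_gt0 c0 f2 fd.
have sN0 : Num.sqrt N != 0 by rewrite gt_eqF// sqrtr_gt0.
have sN2 : N = Num.sqrt N ^+ 2 by rewrite sqr_sqrtr// ltW.
have k0 : 0 < (c / Num.sqrt N) ^+ 2 by rewrite exprn_gt0// divr_gt0// sqrtr_gt0.
have coef n : ip f (phi n) ^+ 2 = (c / Num.sqrt N) ^+ 2 * ((lam n ^+ 2)^-1 * `|d n| ^+ 2).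
  have l0 := lam_gt0 n; have l1 : lam n != 0 by rewrite gt_eqF.
  have -> : ip f (phi n) = c / Num.sqrt N * d n / lam n.
    apply: (mulfI l1); rewrite fd {1}sN2; field.
    by rewrite l1 sN0.
  rewrite real_normK ?num_real//; field.
  by rewrite l1 sN0.
have [h1 h2] := parseval_scaled k0 f2 coef.
split => //; rewrite h2 norm2E sqrtrM ?ip_ge0// sqrtrV ?(ltW k0)// sqrtr_sqr.
rewrite ger0_norm; last by rewrite divr_ge0 ?sqrtr_ge0// ltW.
rewrite {1}sN2; field.
by rewrite sN0 gt_eqF.
Qed.

Lemma const0_stationary : cvgn (series (termC0 g0 v0 lam phi)) /\
  exists xt, SLbvp_unique p q g0 v0 g1 v1 (Num.sqrt N0) 0 xt /\
    const0 p g0 v0 lam phi = (Num.sqrt N0)^-1 * norm2 r xt.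
Proof.
have [xt [xt_sol xt2 coef]] := SLbvp_solution (Num.sqrt N0) 0.
have p0 : 0 < p 0 by apply: p_gt0; exact: I01_0.
have [h1 h2] := stationary_constant N0_gt0 p0 xt2
  (d := fun n => g0 * D01 (phi n) 0 - v0 * phi n 0)
  (fun n => etrans (coef n) (etrans (congr1 (+%R^~ _) (mulr0 _)) (add0r _))).
by split => //; exists xt.
Qed.

Lemma const1_stationary : cvgn (series (termC1 g1 v1 lam phi)) /\
  exists xb, SLbvp_unique p q g0 v0 g1 v1 0 (Num.sqrt N1) xb /\
    const1 p g1 v1 lam phi = (Num.sqrt N1)^-1 * norm2 r xb.
Proof.
have [xb [xb_sol xb2 coef]] := SLbvp_solution 0 (Num.sqrt N1).
have p1 : 0 < p 1 by apply: p_gt0; exact: I01_1.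
have [h1 h2] := stationary_constant N1_gt0 p1 xb2
  (d := fun n => v1 * phi n 1 - g1 * D01 (phi n) 1)
  (fun n => etrans (coef n) (etrans (congr1 (+%R _) (mulr0 _)) (addr0 _))).
by split => //; exists xb.
Qed.

(** * The evolution problem *)

Lemma ip_phi_le f b n : C0_on I01 f -> (forall z, I01 z -> `|f z| <= b) ->
  `|ip f (phi n)| <= b * J (fun z => r z * `|phi n z|).
Proof.
move=> fc fb; have pc : C0_on I01 (phi n) by exact: phi_C0.
have rc : C0_on I01 (fun z => r z * `|phi n z|) by apply: C0_onM => //; exact: C0_on_normr.
rewrite (le_trans (le_norm_J (ip_C0 fc pc)))// -J_Z//; apply: le_J.
- by apply: C0_on_normr; exact: ip_C0.
- by apply: C0_onM => //; exact: C0_on_cst.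
- move=> z Iz; rewrite !normrM ger0_norm ?(ltW (r_gt0 Iz))// mulrCA.
  by rewrite ler_wpM2r ?fb// mulr_ge0// ltW// r_gt0.
Qed.

Section Evolution.
Context (u : R -> R -> R) (x0 d0 d1 : R -> R) (x : R -> R -> R).
Hypotheses (u_C1 : C1_on2 (@Rplus R) I01 u)
  (x_sol : solE p r q g0 v0 g1 v1 x0 u d0 d1 x).
Local Notation Rplus := (@Rplus R).
Local Notation Rpos := (@Rpos R).

Let c n t := ip (x t) (phi n).
Let xt t z := deriv_on Rpos (x^~ z) t.

Let x_C0 : C0_on2 Rplus I01 x. Proof. by case: x_sol => [[]]. Qed.
Let x_C1 : C1_on2 Rpos I01 x. Proof. by case: x_sol => [[]]. Qed.
Let x_C2 t : 0 <= t -> C2_on I01 (x t). Proof. by case: x_sol => _ + _ _ _; apply. Qed.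
Let xs_C0 t : 0 <= t -> C0_on I01 (x t). Proof. by move=> /x_C2 [[]]. Qed.

Lemma fourier_C0 n : C0_on Rplus (c n).
Proof.
have pc : C0_on I01 (phi n) by exact: phi_C0.
set Jn := J (fun z => r z * `|phi n z|).
have Jn0 : 0 <= Jn by exact: J_r_phi_ge0.
apply/C0_onP => t t0; apply/cvgrPdist_le => e e0.
have e1 : 0 < e / (Jn + 1) by rewrite divr_gt0// ltr_wpDl.
have [del del0 hd] := C0_on2_uniform x_C0 t0 e1.
apply/nbhs_ballP; exists del => //= s; rewrite /ball/= distrC => st s0.
have xtc : C0_on I01 (x t) by apply: xs_C0; rewrite -RplusE.
have xsc : C0_on I01 (x s) by apply: xs_C0; rewrite -RplusE.
rewrite distrC /c -ipB//.
apply: le_trans (ip_phi_le n (C0_onB xsc xtc) (hd s s0 st)) _.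
rewrite -/Jn mulrAC ler_pdivrMr ?ltr_wpDl// ler_pM2l// lerDl; lra.
Qed.

Lemma fourier_is_D n t : 0 < t -> is_D Rpos (c n) t (ip (xt t) (phi n)).
Proof.
move=> t0; have pc : C0_on I01 (phi n) by exact: phi_C0.
set Jn := J (fun z => r z * `|phi n z|).
have Jn0 : 0 <= Jn by exact: J_r_phi_ge0.
case: x_C1 => _ xD _ xt_C0 _.
have Pt : Rpos t by rewrite RposE.
have xtc : C0_on I01 (xt t) by exact: C0_on2_slice xt_C0 Pt.
apply/is_DP => e e0.
have e1 : 0 < e / (Jn + 1) by rewrite divr_gt0// ltr_wpDl.
have [del del0 hd] := C0_on2_uniform xt_C0 Pt e1.
exists del => // s Ps st.
have s0 : 0 < s by rewrite -RposE.
have xsc := xs_C0 (ltW s0); have xc := xs_C0 (ltW t0).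
pose g z := x s z - x t z - (s - t) * xt t z.
have stc : C0_on I01 (fun z => (s - t) * xt t z).
  by apply: C0_onM => //; exact: C0_on_cst.
have gc : C0_on I01 g by apply: C0_onB => //; exact: C0_onB.
have gE : c n s - c n t - ip (xt t) (phi n) * (s - t) = ip g (phi n).
  rewrite /g ipB//; last exact: C0_onB.
  by rewrite ipB// ipZ// mulrC.
have gle z : I01 z -> `|g z| <= e / (Jn + 1) * `|s - t|.
  move=> Iz; rewrite /g (mulrC (s - t)).
  apply: (mean_value_le (f := x^~ z) (f' := fun y => xt y z)) => //.
    by move=> y y0; apply: xD => //; rewrite RposE.
  by move=> y yt y0; apply: hd; rewrite ?RposE//; exact: le_lt_trans st.
rewrite gE; apply: le_trans (ip_phi_le n gc gle) _.
rewrite -/Jn mulrAC ler_wpM2r// mulrAC ler_pdivrMr ?ltr_wpDl// ler_pM2l// lerDl; lra.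
Qed.

(** Green's identity moves the operator from the profile to the eigenfunction;
  the boundary data and u remain as a source. *)
Lemma fourier_equation n t : 0 < t -> is_D Rpos (c n) t
  (- lam n * c n t + (beta1 n * d1 t + beta0 n * d0 t + ip (u t) (phi n))).
Proof.
move=> t0; have pc : C0_on I01 (phi n) by exact: phi_C0.
have x2 := x_C2 (ltW t0); have xc := xs_C0 (ltW t0).
case: x_C1 => _ _ _ xt_C0 _.
have Pt : Rpos t by rewrite RposE.
have xtc : C0_on I01 (xt t) by exact: C0_on2_slice xt_C0 Pt.
have uc : C0_on I01 (u t).
  by case: u_C1 => uc _ _ _ _; apply: C0_on2_slice uc _; rewrite RplusE ltW.
pose F z := D01 (fun z => p z * D01 (x t) z) z - q z * x t z.
have Fc : C0_on I01 F by apply: C0_onB; [exact: C2_flux_C0|exact: C0_onM].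
have hF : SLsol 0 F (x t) (fun z => p z * D01 (x t) z).
  by apply: C2_SLsol => // z Iz; rewrite /F; ring.
have [b0 b1] : bc0 g0 v0 (x t) = d0 t /\ bc1 g1 v1 (x t) = d1 t.
  by case: x_sol => _ _ _ + _; apply; exact: ltW.
have green := green_phi n Fc hF; rewrite b0 b1 in green.
have Fpc : C0_on I01 (fun z => F z * phi n z) by exact: C0_onM.
have -> : - lam n * c n t + (beta1 n * d1 t + beta0 n * d0 t + ip (u t) (phi n))
    = ip (xt t) (phi n); last exact: fourier_is_D.
rewrite -green /c mulNr -addrA addKr.
rewrite -J_D//; last exact: ip_C0.
apply: J_eq_oo.
- by apply: C0_onD => //; exact: ip_C0.
- exact: ip_C0.
- move=> z z01; have Iz : I01 z by rewrite I01E; lra.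
  case: x_sol => _ _ + _ _ => /(_ t z t0 z01); rewrite -/(xt t z) => ->.
  rewrite /F C2_flux_D01//; field.
  by rewrite gt_eqF// r_gt0.
Qed.

Lemma fourier_bound n t D0 D1 U : 0 <= t ->
  (forall s, 0 <= s <= t -> `|d0 s| <= D0) ->
  (forall s, 0 <= s <= t -> `|d1 s| <= D1) ->
  (forall s z, 0 <= s <= t -> I01 z -> `|u s z| <= U) ->
  `|c n t| <= expR (- lam n * t) * `|c n 0| + (1 - expR (- lam n * t)) *
    ((`|beta0 n| * D0 + `|beta1 n| * D1 + U * J (fun z => r z * `|phi n z|)) / lam n).
Proof.
move=> t0 h0 h1 hu.
apply: (scalar_decay (lam_gt0 n) t0 (@fourier_C0 n)
  (h := fun s => beta1 n * d1 s + beta0 n * d0 s + ip (u s) (phi n))).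
  by move=> s /andP[s0 _]; exact: fourier_equation.
move=> s /andP[s0 st]; have st' : 0 <= s <= t by rewrite !ltW.
have uc : C0_on I01 (u s).
  by case: u_C1 => uc _ _ _ _; apply: C0_on2_slice uc _; rewrite RplusE ltW.
rewrite (le_trans (ler_normD _ _))// lerD//; last by apply: ip_phi_le => // z; exact: hu.
rewrite (le_trans (ler_normD _ _))// addrC !normrM lerD// ler_wpM2l// ?h0 ?h1//.
Qed.

End Evolution.

(** Square the bound on each coefficient, separate initial value, boundary data
  and source with weights that do not depend on n, and sum: Parseval on the left
  and Bessel for the initial value. *)
Lemma iss_estimate (x0 : R -> R) (u : R -> R -> R) (d0 d1 : R -> R) (x : R -> R -> R) :
  C1_on2 (@Rplus R) I01 u -> C0_on (@Rplus R) d0 -> C0_on (@Rplus R) d1 ->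
  solE p r q g0 v0 g1 v1 x0 u d0 d1 x ->
  cvgn (series (termC0 g0 v0 lam phi)) -> cvgn (series (termC1 g1 v1 lam phi)) ->
  forall eps omega t : R, 0 < eps -> 0 < omega -> 0 <= t ->
    norm2 r (x t) <=
      Num.sqrt (expR (- lam 0%N * t) / (2 - expR (- lam 0%N * t)))
        * norm2 r (x 0)
      + const0 p g0 v0 lam phi * Num.sqrt ((1 + eps^-1) * (1 + omega))
        * max_on `[0, t] (fun s => `|d0 s|)
      + const1 p g1 v1 lam phi * Num.sqrt ((1 + eps) * (1 + omega))
        * max_on `[0, t] (fun s => `|d1 s|)
      + constt r lam phi * Num.sqrt (1 + omega^-1)
        * max_on `[0, t] (fun s => max_on I01 (fun z => `|u s z|)).
Proof.
move=> u1 d0c d1c xs C0cvg C1cvg eps omega t eps0 omega0 t0.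
have tplus : `[0, t] `<=` (@Rplus R).
  by move=> s /=; rewrite RplusE in_itv /= => /andP[].
have [x_2 x_00] : (forall s, 0 <= s -> C2_on I01 (x s)) /\ C0_on I01 (x 0).
  by case: xs => _ h _ _ _; split => //; case: (h 0 (lexx 0)) => [[]].
set D0 := max_on _ (fun s => `|d0 s|); set D1 := max_on _ (fun s => `|d1 s|).
set U := max_on _ (fun s => max_on _ _).
have hD0 s : 0 <= s <= t -> `|d0 s| <= D0.
  move=> st; apply: (@max_on_ge _ 0 t (fun s => `|d0 s|)) => //.
  by apply: C0_on_normr; exact: C0_on_sub d0c.
have hD1 s : 0 <= s <= t -> `|d1 s| <= D1.
  move=> st; apply: (@max_on_ge _ 0 t (fun s => `|d1 s|)) => //.
  by apply: C0_on_normr; exact: C0_on_sub d1c.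
have uc : C0_on2 (@Rplus R) I01 u by case: u1.
have us_C0 s : 0 <= s -> C0_on I01 (u s).
  by move=> s0; apply: C0_on2_slice uc _; rewrite RplusE.
have hU s z : 0 <= s <= t -> I01 z -> `|u s z| <= U.
  move=> st Iz.
  have le1 : `|u s z| <= max_on I01 (fun z => `|u s z|).
    apply: (@max_on_ge _ 0 1 (fun z => `|u s z|)); last by rewrite -I01E.
    by apply: C0_on_normr; apply: us_C0; case/andP: st.
  apply: (le_trans le1); apply: ub_le_sup; last by exists s => //=; rewrite in_itv.
  have [M hM] := C0_on2_bounded t uc.
  exists M => _ [y /= + <-]; rewrite in_itv /= => yt.
  apply: ge_sup; first by exists (`|u y 0|), 0 => //; exact: I01_0.
  by move=> _ [z' Iz' <-]; exact: hM.
have D00 : 0 <= D0 by apply: le_trans (hD0 0 _) => //; rewrite lexx.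
have D10 : 0 <= D1 by apply: le_trans (hD1 0 _) => //; rewrite lexx.
have U0 : 0 <= U by apply: le_trans (hU 0 0 _ I01_0) => //; rewrite lexx.
set e0 := expR (- lam 0%N * t).
set C0 := const0 _ _ _ _ _; set C1 := const1 _ _ _ _ _; set Ct := constt _ _ _.
set E := e0 / (2 - e0).
have e01 : e0 <= 1.
  by rewrite /e0 -expR0 ler_expR mulNr oppr_le0 mulr_ge0// ltW.
have e00 : 0 < e0 by exact: expR_gt0.
have E0 : 0 <= E by rewrite divr_ge0 ?ltW//; lra.
pose k0 := (1 + eps^-1) * (1 + omega); pose k1 := (1 + eps) * (1 + omega).
pose kt := 1 + omega^-1.
have ei0 : 0 < eps^-1 by rewrite invr_gt0.
have oi0 : 0 < omega^-1 by rewrite invr_gt0.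
have k00 : 0 <= k0 by rewrite mulr_ge0//; lra.
have k10 : 0 <= k1 by rewrite mulr_ge0//; lra.
have kt0 : 0 <= kt by rewrite /kt; lra.
pose b0 := p 0 / N0; pose b1 := p 1 / N1.
have b00 : 0 <= b0 by exact: (divr_ge0 (ltW (p_gt0 I01_0)) (ltW N0_gt0)).
have b10 : 0 <= b1 by exact: (divr_ge0 (ltW (p_gt0 I01_1)) (ltW N1_gt0)).
pose tC0 := termC0 g0 v0 lam phi; pose tC1 := termC1 g1 v1 lam phi.
pose tCt := termCt r lam phi.
have li2 n : 0 <= (lam n ^+ 2)^-1 by rewrite invr_ge0 sqr_ge0.
have tC0_ge0 n : 0 <= tC0 n by rewrite mulr_ge0 ?sqr_ge0.
have tC1_ge0 n : 0 <= tC1 n by rewrite mulr_ge0 ?sqr_ge0.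
have tCt_ge0 n : 0 <= tCt n by rewrite mulr_ge0 ?sqr_ge0.
have term n : ip (x t) (phi n) ^+ 2 <= E * ip (x 0) (phi n) ^+ 2 +
    (k0 * D0 ^+ 2 * b0 ^+ 2 * tC0 n + k1 * D1 ^+ 2 * b1 ^+ 2 * tC1 n +
     kt * U ^+ 2 * tCt n).
  have l0 := lam_gt0 n; have l1 : lam n != 0 by rewrite gt_eqF.
  have := fourier_bound u1 xs n t0 hD0 hD1 hU.
  set A0 := `|beta0 n| * D0; set A1 := `|beta1 n| * D1.
  set At := U * J _; set en := expR _ => hb.
  have A00 : 0 <= A0 by rewrite mulr_ge0.
  have A10 : 0 <= A1 by rewrite mulr_ge0.
  have At0 : 0 <= At by rewrite mulr_ge0// J_r_phi_ge0.
  have en0 : 0 < en by exact: expR_gt0.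
  have ene : en <= e0.
    rewrite ler_expR !mulNr lerN2 ler_wpM2r//.
    case: lam_phi => inc _ _; case: n {hb l0 l1 A0 A1 At en A00 A10 At0 en0} => [//|n].
    by rewrite ltW// inc.
  have sq : ip (x t) (phi n) ^+ 2 <=
      (en * `|ip (x 0) (phi n)| + (1 - en) * ((A0 + A1 + At) / lam n)) ^+ 2.
    rewrite -real_normK ?num_real//; apply: lerXn2r => //; rewrite nnegrE//.
    by rewrite (le_trans _ hb).
  apply: (le_trans sq); apply: (le_trans (decay_square _ _ en0 ene e01)).
  rewrite real_normK ?num_real// lerD2l expr_div_n ler_pdivrMr ?exprn_gt0//.
  have y1 := young_square (A0 + A1) At omega0.
  have y2 := young_square A0 A1 ei0; rewrite invrK in y2.
  have y3 : (1 + omega) * (A0 + A1) ^+ 2 <=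
      (1 + omega) * ((1 + eps^-1) * A0 ^+ 2 + (1 + eps) * A1 ^+ 2).
    by rewrite ler_wpM2l//; lra.
  apply: le_trans y1 _.
  have a0E : A0 ^+ 2 = D0 ^+ 2 * b0 ^+ 2 * tC0 n * lam n ^+ 2.
    rewrite /A0 exprMn real_normK ?num_real// /tC0 /termC0 real_normK ?num_real//.
    have -> : beta0 n = b0 * (g0 * D01 (phi n) 0 - v0 * phi n 0) by [].
    by set y := _ - _; field.
  have a1E : A1 ^+ 2 = D1 ^+ 2 * b1 ^+ 2 * tC1 n * lam n ^+ 2.
    rewrite /A1 exprMn real_normK ?num_real// /tC1 /termC1 real_normK ?num_real//.
    have -> : beta1 n = b1 * (v1 * phi n 1 - g1 * D01 (phi n) 1) by [].
    by set y := _ - _; field.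
  have atE : At ^+ 2 = U ^+ 2 * tCt n * lam n ^+ 2.
    have -> : tCt n = (lam n ^+ 2)^-1 * J (fun z => r z * `|phi n z|) ^+ 2 by [].
    by rewrite /At; set y := J _; field.
  rewrite atE; rewrite a0E a1E in y3.
  rewrite /k0 /k1 /kt; lra.
have total N : series (fun n => ip (x t) (phi n) ^+ 2) N <=
    E * ip (x 0) (x 0) + (k0 * D0 ^+ 2 * C0 ^+ 2 + k1 * D1 ^+ 2 * C1 ^+ 2 +
      kt * U ^+ 2 * Ct ^+ 2).
  have lim_ge0 (v : R^nat) : (forall n, 0 <= v n) -> cvgn (series v) -> 0 <= limn (series v).
    by move=> v0' vc; apply: le_trans (series_le_lim 0 v0' vc); rewrite /series /= big_geq.
  have C0E : C0 ^+ 2 = b0 ^+ 2 * limn (series tC0).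
    by rewrite /C0 /const0 exprMn sqr_sqrtr// lim_ge0.
  have C1E : C1 ^+ 2 = b1 ^+ 2 * limn (series tC1).
    by rewrite /C1 /const1 exprMn sqr_sqrtr// lim_ge0.
  have CtE : Ct ^+ 2 = limn (series tCt).
    by rewrite /Ct /constt sqr_sqrtr// lim_ge0//; exact: termCt_cvg.
  have s0 := series_le_lim N tC0_ge0 C0cvg.
  have s1 := series_le_lim N tC1_ge0 C1cvg.
  have st := series_le_lim N tCt_ge0 termCt_cvg.
  have sx := bessel N x_00.
  apply: (@le_trans _ _ (E * series (fun n => ip (x 0) (phi n) ^+ 2) N +
    (k0 * D0 ^+ 2 * b0 ^+ 2 * series tC0 N + k1 * D1 ^+ 2 * b1 ^+ 2 * series tC1 N +
     kt * U ^+ 2 * series tCt N))).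
    rewrite /series /= !mulr_sumr -!big_split /=; apply: ler_sum => n _; exact: term.
  rewrite C0E C1E CtE (mulrA _ (b0 ^+ 2)) (mulrA _ (b1 ^+ 2)).
  apply: lerD; first by rewrite ler_wpM2l.
  apply: lerD; first apply: lerD; rewrite ler_wpM2l//.
  - exact: (mulr_ge0 (mulr_ge0 k00 (sqr_ge0 _)) (sqr_ge0 _)).
  - exact: (mulr_ge0 (mulr_ge0 k10 (sqr_ge0 _)) (sqr_ge0 _)).
  - exact: (mulr_ge0 kt0 (sqr_ge0 _)).
have fin : ip (x t) (x t) <= E * ip (x 0) (x 0) + (k0 * D0 ^+ 2 * C0 ^+ 2 +
    k1 * D1 ^+ 2 * C1 ^+ 2 + kt * U ^+ 2 * Ct ^+ 2).
  have pv := parseval (x_2 t t0).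
  exact: (ler_cvg_to pv (cvg_cst _) (nearW _ total)).
have C00 : 0 <= C0 by exact: (mulr_ge0 b00 (sqrtr_ge0 _)).
have C10 : 0 <= C1 by exact: (mulr_ge0 b10 (sqrtr_ge0 _)).
have Ct0 : 0 <= Ct by exact: sqrtr_ge0.
pose X0 := Num.sqrt E * norm2 r (x 0); pose X1 := C0 * Num.sqrt k0 * D0.
pose X2 := C1 * Num.sqrt k1 * D1; pose X3 := Ct * Num.sqrt kt * U.
have X00 : 0 <= X0 by exact: (mulr_ge0 (sqrtr_ge0 _) (sqrtr_ge0 _)).
have X10 : 0 <= X1 by exact: (mulr_ge0 (mulr_ge0 C00 (sqrtr_ge0 _)) D00).
have X20 : 0 <= X2 by exact: (mulr_ge0 (mulr_ge0 C10 (sqrtr_ge0 _)) D10).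
have X30 : 0 <= X3 by exact: (mulr_ge0 (mulr_ge0 Ct0 (sqrtr_ge0 _)) U0).
rewrite -/k0 -/k1 -/kt -/X0 -/X1 -/X2 -/X3.
have Xs : 0 <= X0 + X1 + X2 + X3 by rewrite !addr_ge0.
rewrite norm2E -(ger0_norm Xs) -sqrtr_sqr ler_wsqrtr//.
apply: (le_trans fin).
have -> : E * ip (x 0) (x 0) = X0 ^+ 2 by rewrite exprMn sqr_sqrtr// norm2_sqr.
have sq3 (a b c : R) : (a * b * c) ^+ 2 = b ^+ 2 * c ^+ 2 * a ^+ 2 by ring.
have -> : k0 * D0 ^+ 2 * C0 ^+ 2 = X1 ^+ 2 by rewrite /X1 sq3 (sqr_sqrtr k00).
have -> : k1 * D1 ^+ 2 * C1 ^+ 2 = X2 ^+ 2 by rewrite /X2 sq3 (sqr_sqrtr k10).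
have -> : kt * U ^+ 2 * Ct ^+ 2 = X3 ^+ 2 by rewrite /X3 sq3 (sqr_sqrtr kt0).
have m01 : 0 <= X0 * X1 by rewrite mulr_ge0.
have m02 : 0 <= X0 * X2 by rewrite mulr_ge0.
have m03 : 0 <= X0 * X3 by rewrite mulr_ge0.
have m12 : 0 <= X1 * X2 by rewrite mulr_ge0.
have m13 : 0 <= X1 * X3 by rewrite mulr_ge0.
have m23 : 0 <= X2 * X3 by rewrite mulr_ge0.
lra.
Qed.

End SturmLiouvilleEquation.

Theorem theorem2p3 (R : realType) (p r q : R -> R) (g0 v0 g1 v1 : R)
    (lam : nat -> R) (phi : nat -> R -> R)
    (p_C1 : C1_on I01 p) (p_gt0 : forall z, I01 z -> 0 < p z)
    (r_C0 : C0_on I01 r) (r_gt0 : forall z, I01 z -> 0 < r z)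
    (q_C0 : C0_on I01 q)
    (hyp_i : 0 < v0 \/ (v0 = 0 /\ g0 < 0))
    (hyp_ii : 0 < v1 \/ (v1 = 0 /\ 0 < g1))
    (lam_phi : SLspectrum p r q g0 v0 g1 v1 lam phi)
    (hyp_iii1 : 0 < lam 0%N)
    (hyp_iii2 : cvgn (series (fun n =>
       (lam n)^-1 * max_on I01 (fun z => `|phi n z|)))) :
  let C0 := const0 p g0 v0 lam phi in
  let C1 := const1 p g1 v1 lam phi in
  let Ct := constt r lam phi in
  [/\ cvgn (series (termC0 g0 v0 lam phi)),
      cvgn (series (termC1 g1 v1 lam phi)) &
      cvgn (series (termCt r lam phi))] /\
  (exists xt : R -> R,
     SLbvp_unique p q g0 v0 g1 v1 (Num.sqrt (g0 ^+ 2 + v0 ^+ 2)) 0 xt /\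
     C0 = (Num.sqrt (g0 ^+ 2 + v0 ^+ 2))^-1 * norm2 r xt) /\
  (exists xb : R -> R,
     SLbvp_unique p q g0 v0 g1 v1 0 (Num.sqrt (g1 ^+ 2 + v1 ^+ 2)) xb /\
     C1 = (Num.sqrt (g1 ^+ 2 + v1 ^+ 2))^-1 * norm2 r xb) /\
  (forall (x0 : R -> R) (u : R -> R -> R) (d0 d1 : R -> R) (x : R -> R -> R),
     C2_on I01 x0 -> C1_on2 Rplus I01 u ->
     Phi p r q g0 v0 g1 v1 x0 u (d0, d1) ->
     solE p r q g0 v0 g1 v1 x0 u d0 d1 x ->
     forall eps omega t : R, 0 < eps -> 0 < omega -> 0 <= t ->
       norm2 r (x t) <=
         Num.sqrt (expR (- lam 0%N * t) / (2 - expR (- lam 0%N * t)))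
           * norm2 r (x 0)
         + C0 * Num.sqrt ((1 + eps^-1) * (1 + omega))
           * max_on `[0, t] (fun s => `|d0 s|)
         + C1 * Num.sqrt ((1 + eps) * (1 + omega))
           * max_on `[0, t] (fun s => `|d1 s|)
         + Ct * Num.sqrt (1 + omega^-1)
           * max_on `[0, t] (fun s => max_on I01 (fun z => `|u s z|))).
Proof.
move=> C0 C1 Ct.
have [c0 xt_ex] := const0_stationary p_C1 p_gt0 r_C0 r_gt0 q_C0 hyp_i hyp_ii
  lam_phi hyp_iii1 hyp_iii2.
have [c1 xb_ex] := const1_stationary p_C1 p_gt0 r_C0 r_gt0 q_C0 hyp_i hyp_ii
  lam_phi hyp_iii1 hyp_iii2.
have ct := termCt_cvg r_C0 r_gt0 lam_phi hyp_iii1 hyp_iii2.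
do 3?[split => //] => x0 u d0 d1 x _ u1 [d0_C1 d1_C1 _] xs eps omega t.
have [d0_C0 _ _] := d0_C1; have [d1_C0 _ _] := d1_C1.
exact: (iss_estimate p_C1 p_gt0 r_C0 r_gt0 q_C0 hyp_i hyp_ii lam_phi hyp_iii1
  hyp_iii2 u1 d0_C0 d1_C0 xs c0 c1).
Qed.
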